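(* Let $\mathcal{M}$ be a super-manifold with basis manifold $M$, and let $\mathcal{F}$ be a regular super-foliation of codimension $0+\epsilon 1$ on $\mathcal{M}$ with a trivial supplement, i.e. determined by an even $1$-form $a\in\Omega(\mathcal{M})$ (so that $\mathrm{Vect}(\mathcal{F})=\{Y\in \mathrm{Vect}(\mathcal{M}) \mid a(Y)=0\}$). Let $\mathcal{X}$ be a super-vector field on $\mathcal{M}$ such that $a(\mathcal{X})=1$. Let $p:\Omega(\mathcal{M})\to\Omega(M)$ be the canonical projection. Then the $1$-form $p(L_{\mathcal{X}}a)\in\Omega^1(M)$ is closed, and its cohomology class in $H^1(M,\mathbb{R})$ does not depend on the choices of $a$ and $\mathcal{X}$: if $a'$ is another even $1$-form determining the same super-foliation $\mathcal{F}$ and $\mathcal{X}'$ is a super-vector field with $a'(\mathcal{X}')=1$, then $[p(L_{\mathcal{X}}a)]=[p(L_{\mathcal{X}'}a')]$ in $H^1(M,\mathbb{R})$.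
   Context: Super-manifolds are smooth real super-manifolds. For a super-manifold $\mathcal{M}$ of dimension $(p,q)$ with basis (underlying smooth) manifold $M$, $\mathcal{O}(\mathcal{M})$ denotes the super-algebra of super-functions, $\mathrm{Vect}(\mathcal{M})$ the Lie super-algebra of super-vector fields (super-derivations of $\mathcal{O}(\mathcal{M})$), and $(\Omega(\mathcal{M}),d)$ the super-algebra of differential forms with its de Rham differential. Parity of forms is the total parity: in local coordinates $x_1,\dots,x_p$ (even) and $\theta_1,\dots,\theta_q$ (odd), the form $dx_i$ is odd and $d\theta_j$ is even, the parities of coefficient functions are added to these, and $\alpha\wedge\beta=(-1)^{|\alpha||\beta|}\beta\wedge\alpha$ for homogeneous forms. Thus an even $1$-form is locally $\sum_i f_i\,dx_i+\sum_j g_j\,d\theta_j$ with $f_i$ odd and $g_j$ even. The canonical projection $p:\Omega(\mathcal{M})\to\Omega(M)$ is the restriction of forms to the basis manifold: it is the morphism of differential algebras given locally by $x_i\mapsto x_i$, $dx_i\mapsto dx_i$, $\theta_j\mapsto 0$, $d\theta_j\mapsto 0$. $\iota_{\mathcal{X}}$ denotes contraction with $\mathcal{X}$, so $a(\mathcal{X})=\iota_{\mathcal{X}}a$, and $L_{\mathcal{X}}$ denotes the Lie derivative on forms, given by the super Cartan formula (linear in $\mathcal{X}$), normalized so that $L_{\mathcal{X}}a=\iota_{\mathcal{X}}da$ when $\iota_{\mathcal{X}}a$ is constant. Regular super-foliation of codimension $n+\epsilon m$: on $\mathbb{R}^{p,q}$ with natural coordinates $x_1,\dots,x_p,\theta_1,\dots,\theta_q$,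 let $\mathcal{B}$ be the $\mathcal{O}(\mathbb{R}^{p,q})$-submodule of $\mathrm{Vect}(\mathbb{R}^{p,q})$ generated by $\frac{\partial}{\partial x_1},\dots,\frac{\partial}{\partial x_{p-n}}$ and $\frac{\partial}{\partial\theta_1},\dots,\frac{\partial}{\partial\theta_{q-m}}$. A regular super-foliation $\mathcal{F}$ of codimension $n+\epsilon m$ on $\mathcal{M}$ is a Lie sub-super-algebra $\mathrm{Vect}(\mathcal{F})$ of $\mathrm{Vect}(\mathcal{M})$ such that every $x\in M$ has a neighborhood $\mathcal{U}$ and a diffeomorphism from $\mathcal{U}$ to $\mathbb{R}^{p,q}$ that provides an isomorphism between the restriction of $\mathrm{Vect}(\mathcal{F})$ to $\mathcal{U}$ and $\mathcal{B}$. Here $n=0$ and $m=1$. Trivial supplement: $\mathcal{F}$ has a trivial supplement if there exist odd $1$-forms $\omega_1,\dots,\omega_n$ and even $1$-forms $a_1,\dots,a_m$ generating a free $\mathcal{O}(\mathcal{M})$-module of super-dimension $n+\epsilon m$ such that $\mathrm{Vect}(\mathcal{F})$ is the set of super-vector fields annihilated by all of them. For codimension $0+\epsilon 1$ this means a single even $1$-form $a$, generating a free module, with $\mathrm{Vect}(\mathcal{F})=\ker a$; ''$a$ determines $\mathcal{F}$'' means this. *)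

(* Defs.v *)
From HB Require Import structures.
From mathcomp Require Import all_boot all_order all_algebra.
From mathcomp Require Import all_classical all_reals.
From mathcomp Require Import topology normedtype derive.

Set Implicit Arguments.
Unset Strict Implicit.
Unset Printing Implicit Defensive.
Import Order.TTheory GRing.Theory Num.Theory.
Import numFieldNormedType.Exports.
Local Open Scope classical_set_scope.
Local Open Scope ring_scope.

(** * Super-algebras, super-derivations and the Cartan calculus

  The structure of [R]-algebra is given by the central morphism [scal], and
  [hpart b f] is the component of [f] of parity [b] ([false] = even).  The zero
  ring is allowed, being the algebra of functions on the empty set; this is why
  [GRing.Algebra], whose elements are nontrivial rings, is not used. *)

HB.mixin Record isSuperAlgebra (R : pzRingType) A of GRing.PzRing A := {
  scal : R -> A;
  hpart : bool -> A -> A;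
  scal_one : scal 1 = 1;
  scalD : forall k l, scal (k + l) = scal k + scal l;
  scalM : forall k l, scal (k * l) = scal k * scal l;
  scalC : forall k (f : A), scal k * f = f * scal k;
  hpartD : forall b (f g : A), hpart b (f + g) = hpart b f + hpart b g;
  hpart_scal : forall b k (f : A), hpart b (scal k * f) = scal k * hpart b f;
  hpart_sum : forall f, hpart false f + hpart true f = f;
  hpart_hpart : forall b c f, hpart b (hpart c f) = if b == c then hpart c f else 0;
  hpartM : forall b c f g,
    hpart (b (+) c) (hpart b f * hpart c g) = hpart b f * hpart c g
}.

#[short(type="superAlgType")]
HB.structure Definition SuperAlgebra (R : pzRingType) :=
  {A of isSuperAlgebra R A & GRing.PzRing A}.

Section Cartan.
Variables (R : pzRingType) (A : superAlgType R).
Implicit Types (X Y Z : A -> A) (f g : A) (b c : bool).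

Definition homog b f : Prop := hpart b f = f.

(* Component of parity [b] of a linear endomorphism of [A]. *)
Definition vpart b X : A -> A :=
  fun f => hpart b (X (hpart false f)) + hpart (~~ b) (X (hpart true f)).

(* Super-vector fields, not necessarily homogeneous: the linear maps both of
   whose homogeneous components satisfy the graded Leibniz rule. *)
Definition Vect : set (A -> A) := [set X |
  (forall (k : R) f g, X (scal k * f + g) = scal k * X f + X g) /\
  (forall b c f g, homog c f ->
     vpart b X (f * g) = vpart b X f * g + (-1) ^+ (b && c) * (f * vpart b X g))].

Definition bracket X Y : A -> A := fun f =>
  \sum_(b : bool) \sum_(c : bool)
    (vpart b X (vpart c Y f) - (-1) ^+ (b && c) * vpart c Y (vpart b X f)).

Definition lie_subsuperalgebra (F : set (A -> A)) : Prop :=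
  [/\ F `<=` Vect,
      F (fun=> 0),
      forall (k : R) Y Z, F Y -> F Z -> F (fun f => scal k * Y f + Z f),
      forall b Y, F Y -> F (vpart b Y) &
      forall Y Z, F Y -> F Z -> F (bracket Y Z)].

(** A 1-form [w] is given by its contractions [w Y] (the contraction of [w]
  with [Y]), an [A]-linear map from vector fields to [A]; its values outside
  [Vect] are irrelevant.  A 2-form [o] is given by [o X Y], the contraction
  with [Y] of the contraction of [o] with [X].

  All signs follow from the total parity: [d] is odd, contraction with [X] has
  parity [|X| + 1] and [L_X] has parity [|X|], with
    [L_X = i_X d + (-1)^|X| d i_X],   [i_Y d f = Y f],
    [L_X i_Y - (-1)^(|X| (|Y| + 1)) i_Y L_X = i_[X,Y]]. *)

Definition form_linear (w : (A -> A) -> A) : Prop :=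
  (forall Y Z, Vect Y -> Vect Z -> w (fun f => Y f + Z f) = w Y + w Z) /\
  (forall f Y, Vect Y -> w (fun g => f * Y g) = f * w Y).

(* A 1-form is even when it shifts parity: [d x_i] is odd for [x_i] even. *)
Definition form_even (w : (A -> A) -> A) : Prop :=
  forall b Y, Vect Y -> vpart b Y = Y -> homog (~~ b) (w Y).

Definition d0 f : (A -> A) -> A := fun Y => Y f.

Definition d1 (w : (A -> A) -> A) : (A -> A) -> (A -> A) -> A := fun X Y =>
  \sum_(b : bool) \sum_(c : bool)
    let Xb := vpart b X in
    let Yc := vpart c Y in
    (-1) ^+ (b && ~~ c) * (Xb (w Yc) - w (bracket Xb Yc))
    - (-1) ^+ b * Yc (w Xb).

Definition lie_derivative X (w : (A -> A) -> A) : (A -> A) -> A := fun Y =>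
  \sum_(b : bool) (d1 w (vpart b X) Y + (-1) ^+ b * d0 (w (vpart b X)) Y).

End Cartan.

(** * Smooth functions on open subsets of R^p, and Grassmann coefficients *)

Definition partial (R : realType) (p : nat) (i : 'I_p) (f : 'rV[R]_p -> R) :
    'rV[R]_p -> R :=
  fun y => 'D_(delta_mx 0 i : 'rV[R]_p) f y.

Definition iter_partial (R : realType) (p : nat) (s : seq 'I_p)
    (f : 'rV[R]_p -> R) : 'rV[R]_p -> R :=
  foldr (fun i g => partial i g) f s.

Definition smooth_on (R : realType) (p : nat) (V : set 'rV[R]_p)
    (f : 'rV[R]_p -> R) : Prop :=
  forall (s : seq 'I_p) y, V y ->
    {for y, continuous (iter_partial s f)} /\
    (forall i : 'I_p,
       derivable (iter_partial s f) y (delta_mx 0 i : 'rV[R]_p)).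

(* [F : {set 'I_q} -> 'rV[R]_p -> R] stands for the super-function
   [\sum_I F_I(x) theta_I], where [theta_I] is the product of the [theta_i],
   [i] in [I], in increasing order. *)
Section Grassmann.
Variables (R : realType) (p q : nat).
Implicit Types (F G : {set 'I_q} -> 'rV[R]_p -> R) (I J K : {set 'I_q}).

Definition grassmann_inv I J : nat :=
  #|[pred ij : 'I_q * 'I_q | [&& ij.1 \in I, ij.2 \in J & (ij.2 < ij.1)%N]]|.

Definition gmul F G : {set 'I_q} -> 'rV[R]_p -> R := fun K y =>
  \sum_(I : {set 'I_q} | I \subset K)
    (-1) ^+ grassmann_inv I (K :\: I) * F I y * G (K :\: I) y.

Definition gdx (i : 'I_p) F : {set 'I_q} -> 'rV[R]_p -> R :=
  fun K => partial i (F K).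

Definition gdtheta (j : 'I_q) F : {set 'I_q} -> 'rV[R]_p -> R := fun K y =>
  if j \in K then 0
  else (-1) ^+ #|[pred i in K | (i < j)%N]| * F (j |: K) y.

End Grassmann.

(** * Super-manifolds

  Presheaf data on a topological space.  Only the values on open sets matter,
  [res U V] is the restriction for [V `<=` U] and [ev U f x] is the value at
  [x] in [U] of the body of [f]. *)

Record superSpace (R : realType) := SuperSpace {
  base :> topologicalType;
  sec : set base -> superAlgType R;
  res : forall U V : set base, sec U -> sec V;
  ev : forall U : set base, sec U -> base -> R
}.

Arguments sec {R} s U.
Arguments res {R s} U V _.
Arguments ev {R s U} _ _.

Record is_sheaf (R : realType) (M : superSpace R) : Prop := IsSheaf {
  resD : forall (U V : set M) (f g : sec M U),
    open U -> open V -> V `<=` U -> res U V (f + g) = res U V f + res U V g;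
  resM : forall (U V : set M) (f g : sec M U),
    open U -> open V -> V `<=` U -> res U V (f * g) = res U V f * res U V g;
  res_scal : forall (U V : set M) (k : R),
    open U -> open V -> V `<=` U -> res U V (scal k : sec M U) = scal k;
  res_hpart : forall (U V : set M) b (f : sec M U),
    open U -> open V -> V `<=` U -> res U V (hpart b f) = hpart b (res U V f);
  res_id : forall (U : set M) (f : sec M U), open U -> res U U f = f;
  res_comp : forall (U V W : set M) (f : sec M U),
    open U -> open V -> open W -> V `<=` U -> W `<=` V ->
    res V W (res U V f) = res U W f;
  sheaf_separated : forall (C : set (set M)) (U : set M) (f g : sec M U),
    (forall V, C V -> open V) -> U = \bigcup_(V in C) V ->
    (forall V, C V -> res U V f = res U V g) -> f = g;
  sheaf_glue : forall (C : set (set M)) (U : set M) (s : forall V, sec M V),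
    (forall V, C V -> open V) -> U = \bigcup_(V in C) V ->
    (forall V W, C V -> C W ->
       res V (V `&` W) (s V) = res W (V `&` W) (s W)) ->
    exists f : sec M U, forall V, C V -> res U V f = s V;
  ev_res : forall (U V : set M) (f : sec M U) x,
    open U -> open V -> V `<=` U -> V x -> ev (res U V f) x = ev f x
}.

(** A chart: an isomorphism from an open sub-super-manifold [dom] onto a
  super-domain of R^{p,q}.  [coef W f] are the Grassmann coefficients of the
  image of a section [f] over [W `<=` dom]; they are meaningful on
  [cmap @` W] only. *)
Record chart (R : realType) (p q : nat) (M : superSpace R) := Chart {
  dom : set M;
  cmap : M -> 'rV[R]_p;
  cinv : 'rV[R]_p -> M;
  coef : forall W : set M, sec M W -> {set 'I_q} -> 'rV[R]_p -> R;
  dom_open : open dom;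
  img_open : open (cmap @` dom);
  cmapK : forall x, dom x -> cinv (cmap x) = x;
  cmap_continuous : forall x, dom x -> {for x, continuous cmap};
  cinv_continuous : forall y, (cmap @` dom) y -> {for y, continuous cinv};
  coef_smooth : forall (W : set M) (f : sec M W) I,
    open W -> W `<=` dom -> smooth_on (cmap @` W) (coef f I);
  coef_onto : forall (W : set M) (F : {set 'I_q} -> 'rV[R]_p -> R),
    open W -> W `<=` dom -> (forall I, smooth_on (cmap @` W) (F I)) ->
    exists f : sec M W, forall I y, (cmap @` W) y -> coef f I y = F I y;
  coef_inj : forall (W : set M) (f g : sec M W),
    open W -> W `<=` dom ->
    (forall I y, (cmap @` W) y -> coef f I y = coef g I y) -> f = g;
  coefD : forall (W : set M) (f g : sec M W) I y,
    open W -> W `<=` dom -> (cmap @` W) y ->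
    coef (f + g) I y = coef f I y + coef g I y;
  coefM : forall (W : set M) (f g : sec M W) I y,
    open W -> W `<=` dom -> (cmap @` W) y ->
    coef (f * g) I y = gmul (coef f) (coef g) I y;
  coef_scal : forall (W : set M) (k : R) I y,
    open W -> W `<=` dom -> (cmap @` W) y ->
    coef (scal k : sec M W) I y = if I == finset.set0 then k else 0;
  coef_hpart : forall (W : set M) b (f : sec M W) I y,
    open W -> W `<=` dom -> (cmap @` W) y ->
    coef (hpart b f) I y = if odd #|I| == b then coef f I y else 0;
  coef_res : forall (V W : set M) (f : sec M W) I y,
    open V -> open W -> W `<=` dom -> V `<=` W -> (cmap @` V) y ->
    coef (res W V f) I y = coef f I y;
  coef_ev : forall (W : set M) (f : sec M W) x,
    open W -> W `<=` dom -> W x -> coef f finset.set0 (cmap x) = ev f x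
}.

Arguments coef {R p q M} c {W} _ _ _.

(* As for manifolds, the basis is Hausdorff and second countable.  The charts
   of the super-manifold are all the terms of type [chart p q space]. *)
Record superManifold (R : realType) (p q : nat) := SuperManifold {
  space :> superSpace R;
  space_hausdorff : hausdorff_space space;
  space_countable : @second_countable space;
  space_sheaf : is_sheaf space;
  space_charts : forall x : space, exists c : chart p q space, dom c x
}.

Section SuperManifoldTheory.
Variables (R : realType) (p q : nat) (M : superManifold R p q).

Definition superfun : superAlgType R := sec M setT.
Definition mchart := chart p q M.
Definition img (c : mchart) : set 'rV[R]_p := cmap c @` dom c.

Implicit Types (F : set (superfun -> superfun)) (X Y : superfun -> superfun).
Implicit Types (c : mchart).

(** ** Regular super-foliations *)

(* Vector fields on [U] that coincide locally with elements of [F]: the literal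
   restrictions of global fields do not form a module over the functions on
   [U], some of which do not extend to the whole super-manifold. *)
Definition foliation_restr F (U : set M) : set (sec M U -> sec M U) :=
  [set Z | Vect Z /\ forall x, U x -> exists W Y,
     [/\ open W, W x, W `<=` U, F Y &
         forall f : superfun, res setT W (Y f) = res U W (Z (res setT U f))]].

(* The module spanned by the first [p - n] even and the first [q - m] odd
   coordinate vector fields of the chart [c]. *)
Definition coord_span (n m : nat) c : set (sec M (dom c) -> sec M (dom c)) :=
  [set Z | exists (u : 'I_p -> sec M (dom c)) (v : 'I_q -> sec M (dom c)),
     forall (f : sec M (dom c)) I y, img c y ->
       coef c (Z f) I y =
         \sum_(i < p | (i < p - n)%N) gmul (coef c (u i)) (gdx i (coef c f)) I y
       + \sum_(j < q | (j < q - m)%N) gmul (coef c (v j)) (gdtheta j (coef c f)) I y].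

(* Regular super-foliation of codimension [n + epsilon m]. *)
Definition regular_foliation (n m : nat) F : Prop :=
  [/\ (n <= p)%N, (m <= q)%N, lie_subsuperalgebra F &
      forall x : M, exists c, [/\ dom c x, img c = setT &
        @foliation_restr F (dom c) = @coord_span n m c]].

(** ** Differential 1-forms *)

(* Locally a 1-form is a finite sum [\sum_k d g_k . f_k], where [d g . f] is
   written with its coefficient on the right to avoid a sign: its contraction
   with [Y] is [Y g * f]. *)
Definition one_form (w : (superfun -> superfun) -> superfun) : Prop :=
  form_linear w /\
  forall x : M, exists W n (f g : 'I_n -> superfun),
    [/\ open W, W x &
        forall Y, Vect Y ->
          res setT W (w Y) = res setT W (\sum_(k < n) Y (g k) * f k)].

Definition even_one_form (w : (superfun -> superfun) -> superfun) : Prop :=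
  one_form w /\ form_even w.

(* [a] is an even 1-form, generates a free module, and [F] is its kernel. *)
Definition determines (a : (superfun -> superfun) -> superfun) F : Prop :=
  [/\ even_one_form a,
      forall f : superfun, (forall Y, Vect Y -> a Y * f = 0) -> f = 0 &
      F = [set Y | Vect Y /\ a Y = 0]].

(** ** The basis manifold: functions, 1-forms, first cohomology *)

(* A 1-form on the basis is given by its coefficients in all charts, subject to
   [basis_one_form].  The charts of the super-manifold serve as charts of its
   basis: their coordinate changes are smooth by [coef_ev]. *)
Definition basis_family := mchart -> 'I_p -> 'rV[R]_p -> R.
Implicit Types b : basis_family.

Definition basis_smooth (h : M -> R) : Prop :=
  forall c, smooth_on (img c) (h \o cinv c).

Definition basis_one_form b : Prop :=
  (forall c i, smooth_on (img c) (b c i)) /\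
  (forall c c' x i, dom c x -> dom c' x ->
     b c i (cmap c x) =
       \sum_(k < p) partial i (fun y => cmap c' (cinv c y) 0 k) (cmap c x)
                    * b c' k (cmap c' x)).

Definition basis_closed b : Prop :=
  forall c i j y, img c y -> partial i (b c j) y = partial j (b c i) y.

(* Equality of the classes of [b] and [b'] in H^1(M, R). *)
Definition cohomologous b b' : Prop :=
  exists2 h : M -> R, basis_smooth h &
    forall c i y, img c y -> b c i y - b' c i y = partial i (h \o cinv c) y.

(** ** The canonical projection on 1-forms

  If [w = \sum_i f_i dx_i + \sum_j g_j dtheta_j] in a chart, the body of [f_i]
  is that of the contraction of [w] with [d/dx_i].  The latter is only defined
  on the domain of the chart, so [w] is evaluated at [x] on any global vector
  field that coincides with [d/dx_i] near [x]. *)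

Definition is_ddx_near c (i : 'I_p) (x : M) : set (superfun -> superfun) :=
  [set Y | Vect Y /\ exists W, [/\ open W, W x, W `<=` dom c &
     forall (f : superfun) I y, (cmap c @` W) y ->
       coef c (res setT (dom c) (Y f)) I y
       = gdx i (coef c (res setT (dom c) f)) I y]].

Definition form_proj (w : (superfun -> superfun) -> superfun) : basis_family :=
  fun c i y => ev (w (xget (fun=> 0) (is_ddx_near c i (cinv c y)))) (cinv c y).

End SuperManifoldTheory.

(* Main.v *)
Require Import Defs.
From HB Require Import structures.
From mathcomp Require Import all_boot all_order all_algebra.
From mathcomp Require Import all_classical all_reals.
From mathcomp Require Import topology normedtype derive sequences exp.
From mathcomp Require Import ring lra.

(** Let [e] be the evaluation at a point [x] of the basis: it kills odd
  super-functions, so [e o X] satisfies the Leibniz rule without sign for every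
  super-vector field [X].  Writing [a = sum_k dg_k . f_k] near [x], with [X] odd
  and [Y] even, this gives
    [e (X (a Y) - a [X, Y]) = sum_k e (Y g_k) e (X f_k) + e (Y (X g_k)) e (f_k)],
  which is minus the value of [L_X a] on [Y].  Hence [p (L_X a)] is locally a
  sum of terms [u dv] with [u], [v] smooth on the basis, and its value on [Y]
  only depends on [e o Y].

  Closedness: [Y = a(Y) X + Z] with [Z] in the kernel [F] of [a], and
  [e o Z = e o Y] because [a(Y)] is odd.  For even [Z], [Z'] in [F], the Jacobi
  identity and [[F, F] <= F] give
    [e (a [X, [Z, Z']]) = e (Z (a [X, Z']) - Z' (a [X, Z]))],
  and the left-hand side vanishes when [Z], [Z'] are the tangent parts of lifts
  of coordinate fields, by the symmetry of second derivatives.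

  Independence: [a' = a . u] with [u = a'(X)], and [X' - v X] is in [F] with
  [v = a(X')]; then [e v * e u = 1] and [p (L_X a) - p (L_X' a') = d ln |v|].

  Global lifts of coordinate fields, and the locality of vector fields, are
  obtained by cutting off with smooth functions of compact support. *)

Set Implicit Arguments.
Unset Strict Implicit.
Unset Printing Implicit Defensive.
Import Order.TTheory GRing.Theory Num.Theory.
Import numFieldNormedType.Exports.
Local Open Scope classical_set_scope.
Local Open Scope ring_scope.

(** * Calculus in several variables *)

Section Line.
Variables (R : realType) (V : normedModType R).
Implicit Types (f : V -> R) (y v : V).

Lemma derive_line f y v :
  'D_v f y = 'D_1 (fun h : R => f (h *: v + y)) 0.
Proof.
rewrite /derive; set g1 := fun h => h^-1 *: _; set g2 := fun h => h^-1 *: _.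
suff -> : g1 = g2 by [].
by apply/funext => h; rewrite /g1 /g2 /= addr0 scale0r add0r [_%:A]mulr1.
Qed.

(** Reduces differentiation along a direction to one real variable, where the chain rule and the
    mean value theorem apply. *)
Lemma is_derive_line f y v d :
  is_derive y v f d <-> is_derive (0 : R) 1 (fun h : R => f (h *: v + y)) d.
Proof.
split=> -[fd <-]; first by split; [exact: (derivable1P f y v).1|by rewrite (derive_line f)].
by split; [exact: (derivable1P f y v).2|rewrite (derive_line f)].
Qed.

Lemma is_derive1_comp (g phi : R -> R) (x d e : R) :
  is_derive x 1 g d -> is_derive (g x) 1 phi e ->
  is_derive x 1 (phi \o g) (e * d).
Proof.
move=> [gd <-] [pd <-]; split; last first.
  by rewrite -!derive1E (derive1_comp gd pd).
move/derivable1_diffP: (gd) => gd'; move/derivable1_diffP: (pd) => pd'.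
by apply/derivable1_diffP; exact: differentiable_comp.
Qed.

Lemma is_derive_comp (f : V -> R) (phi : R -> R) y v d e :
  is_derive y v f d -> is_derive (f y) 1 phi e ->
  is_derive y v (phi \o f) (e * d).
Proof.
move=> /is_derive_line; rewrite -[f y](_ : (fun h : R => f (h *: v + y)) 0 = _).
  move=> fd pd; apply/is_derive_line; exact: is_derive1_comp fd pd.
by rewrite scale0r add0r.
Qed.

Lemma is_derive_affine (k c t : R) : is_derive t 1 (fun h : R => k * h + c) k.
Proof.
have dk : is_derive t 1 (k \*: (id : R -> R)) (k *: 1) by exact: is_deriveZ.
have := is_deriveD dk (is_derive_cst (c : R^o) t 1).
by rewrite addr0 -[k *: 1]/(k * 1) mulr1.
Qed.

Lemma is_derive_shift_line f y v (t d : R) :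
  is_derive (t *: v + y) v f d -> is_derive t 1 (fun h : R => f (h *: v + y)) d.
Proof.
move=> /is_derive_line [fd fE].
set g := (fun h : R => _) in fd fE.
suff -> : (fun h : R => f (h *: v + y)) = g \o (fun h => h - t).
  have dB : is_derive t 1 (fun h : R => h - t) (1 - 0).
    exact: (is_deriveB (f := id) (g := cst t)).
  have dg : is_derive (t - t) 1 g d by rewrite subrr; split.
  by have := is_derive1_comp dB dg; rewrite subr0 mulr1.
by apply/funext => h; rewrite /g /= addrA -scalerDl subrK.
Qed.

End Line.

(** * The flat functions behind smooth cutoffs *)

Section Flat.
Variable R : realType.

(* The derivatives of [exp (- 1 / t)] are combinations of these functions. *)
Definition flat (n : nat) (t : R) : R :=
  if 0 < t then t ^- n * expR (- t^-1) else 0.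

Lemma flat_gt0 n t : 0 < t -> 0 < flat n t.
Proof. by move=> t0; rewrite /flat t0 mulr_gt0 ?expR_gt0 ?invr_gt0 ?exprn_gt0. Qed.

Lemma flat_le0 n t : t <= 0 -> flat n t = 0.
Proof. by move=> t0; rewrite /flat ltNge t0. Qed.

Lemma flat_ge0 n t : 0 <= flat n t.
Proof. by case: (ltP 0 t) => t0; [exact/ltW/flat_gt0|rewrite flat_le0]. Qed.

(** For [t > 0], the term of degree [n + 2] of the exponential series at [1 / t] is at most
    [exp (1 / t)]. A quadratic bound is what forces the derivative at 0 to vanish. *)
Lemma flat_le_sqr n t : flat n t <= (n.+2)`!%:R * t ^+ 2.
Proof.
case: (ltP 0 t) => t0; last by rewrite flat_le0// mulr_ge0 ?sqr_ge0.
rewrite /flat t0 expRN ler_pdivrMr ?expR_gt0 //.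
have tV0 : 0 < t^-1 by rewrite invr_gt0.
have c0 : 0 < (n.+2)`!%:R * t ^+ 2 by rewrite mulr_gt0 ?exprn_gt0 ?ltr0n ?fact_gt0.
rewrite -ler_pdivrMl //; apply: le_trans (expR_ge1Dxn n.+1 (ltW tV0)).
have -> : ((n.+2)`!%:R * t ^+ 2)^-1 * t ^- n = t^-1 ^+ n.+2 / (n.+2)`!%:R.
  by move: (_`!) => c; rewrite invfM -!exprVn -[n.+2]addn2 exprD; ring.
by rewrite lerDr.
Qed.

(** The difference quotient at 0 is bounded by a constant times [|h|]. *)
Lemma is_derive_le_sqr (f : R -> R) (C : R) : f 0 = 0 ->
  (forall t, `|f t| <= C * t ^+ 2) -> is_derive (0 : R) 1 f 0.
Proof.
move=> f0 fC.
have lim0 : h^-1 *: (f (h *: 1 + 0) - f 0) @[h --> 0^'] --> (0 : R).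
  apply/cvgrPdist_le => e e0.
  have C0 : 0 < `|C| + 1 by rewrite ltr_wpDl.
  near=> h.
  have hn0 : h != 0 by near: h; exact: nbhs_dnbhs_neq.
  rewrite sub0r normrN f0 subr0 addr0 normrZ normfV [_%:A]mulr1.
  rewrite ler_pdivrMl ?normr_gt0 //.
  apply: (le_trans (fC h)).
  rewrite -normr_id -[X in X <= _]ger0_norm; last first.
    by apply: le_trans (fC h).
  rewrite normrM normrX expr2 mulrA normr_id mulrC ler_pM2l ?normr_gt0 //.
  rewrite (@le_trans _ _ ((`|C| + 1) * `|h|)) ?ler_wpM2r ?lerDl //.
  rewrite mulrC -ler_pdivlMr //; near: h.
  by apply: dnbhs0_le; rewrite divr_gt0.
by split; [apply/cvg_ex; exists 0|exact: cvg_lim].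
Unshelve. all: by end_near. Qed.

(** Away from 0 this is the product rule for [t ^ (- n) * exp (- 1 / t)]; at 0 the quadratic bound
    decides. The derivative stays in the span of the family, which gives smoothness by iteration. *)
Lemma is_derive_flat n (t : R) :
  is_derive t 1 (flat n) (flat n.+2 t - n%:R * flat n.+1 t).
Proof.
case: (ltgtP t 0) => [t0|t0|->].
- rewrite !(flat_le0 _ (ltW t0)) mulr0 subr0.
  apply: near_eq_is_derive (is_derive_cst _ _ _).
  by apply: filterS (lt_nbhsl t0) => s s0; rewrite flat_le0 // ltW.
- have -> : flat n.+2 t - n%:R * flat n.+1 t =
      t ^- n * (expR (- t^-1) * t ^- 2) + expR (- t^-1) * (- n%:R * t ^- n.+1).
    rewrite /flat t0 -addn2 -[n.+1]addn1 !exprD !invfM; ring.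
  pose g s : R := s ^- n * expR (- s^-1).
  have ne0 : t != 0 by rewrite gt_eqF.
  apply: (@near_eq_is_derive _ _ _ g).
    by apply: filterS (lt_nbhsr t0) => s s0; rewrite /g /flat s0.
  have dV : is_derive t 1 (fun s : R => s^-1) (- t ^- 2).
    apply: is_derive_eq; first by apply: derivableP; apply: (derivableV (f := id)).
    by rewrite (deriveV (f := id)) // derive_id [_%:A]mulr1.
  have dX : is_derive t 1 (fun s : R => s ^- n) (- n%:R * t ^- n.+1).
    have -> : (fun s : R => s ^- n) = (fun s : R => s^-1) ^+ n.
      by apply/funext => s; rewrite exprfctE exprVn.
    apply: is_derive_eq; rewrite /= exprVn.
    case: (n) => [|m]; first by rewrite !mul0r scale0r oppr0 mul0r.
    rewrite -[LHS]/(m.+1%:R / t ^+ m * - t ^- 2) -[m.+2 in RHS]addn2 exprD; field; rewrite expf_neq0 ne0 //.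
  have dE : is_derive t 1 (fun s : R => expR (- s^-1)) (expR (- t^-1) * t ^- 2).
    apply: (is_derive_comp (f := fun s : R => - s^-1)) => //.
    by rewrite -[X in is_derive _ _ _ X]opprK; apply: is_deriveN.
  exact: is_deriveM dX dE.
- rewrite !flat_le0 // mulr0 subr0; apply: (@is_derive_le_sqr _ (n.+2)`!%:R).
    by rewrite flat_le0.
  by move=> s; rewrite ger0_norm ?flat_ge0 // flat_le_sqr.
Qed.
End Flat.

Lemma is_derive_bigsum (R : realType) (V : normedModType R) (I : Type) (s : seq I) (P : pred I)
    (F : I -> V -> R) (dF : I -> R) (y v : V) :
  (forall i, P i -> is_derive y v (F i) (dF i)) ->
  is_derive y v (fun z => \sum_(i <- s | P i) F i z) (\sum_(i <- s | P i) dF i).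
Proof.
move=> FdF; elim: s => [|i s IH].
  by under eq_fun do rewrite big_nil; rewrite big_nil; exact: is_derive_cst.
under eq_fun do rewrite big_cons; rewrite big_cons; case: ifP => // Pi.
by apply: is_deriveD; exact: FdF.
Qed.

(** * Closure properties of smooth functions on an open set *)

Section Smooth.
Variables (R : realType) (p : nat).
Implicit Types (V W : set 'rV[R]_p) (f g : 'rV[R]_p -> R) (y : 'rV[R]_p).

Lemma near_open_eq V f g y : open V -> V y ->
  (forall z, V z -> f z = g z) -> \forall z \near y, f z = g z.
Proof. by move=> oV Vy fg; apply: filterS (open_nbhs_nbhs (conj oV Vy)). Qed.

Lemma partial_eq V f g i y : open V -> V y ->
  (forall z, V z -> f z = g z) -> partial i f y = partial i g y.
Proof. by move=> oV Vy fg; apply: near_eq_derive; exact: near_open_eq fg. Qed.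

Lemma partialE f i y d : is_derive y (delta_mx 0 i : 'rV[R]_p) f d -> partial i f y = d.
Proof. by case. Qed.

Lemma iter_partial_eq V f g s y : open V -> V y ->
  (forall z, V z -> f z = g z) -> iter_partial s f y = iter_partial s g y.
Proof.
move=> oV Vy fg; elim: s y Vy => [|i s IH] y Vy; first exact: fg.
by apply: (partial_eq (V := V)).
Qed.

Lemma regular_at_eq V f g y : open V -> V y -> (forall z, V z -> f z = g z) ->
  {for y, continuous f} /\ (forall i, derivable f y (delta_mx 0 i : 'rV[R]_p)) ->
  {for y, continuous g} /\ (forall i, derivable g y (delta_mx 0 i : 'rV[R]_p)).
Proof.
move=> oV Vy fg [cf df]; have n := near_open_eq oV Vy fg.
split=> [|i]; last exact: near_eq_derivable (df i).
move: cf; rewrite /prop_for /continuous_at (nbhs_singleton n); apply: cvg_trans.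
exact: (near_eq_cvg n).
Qed.

Lemma smooth_on_eq V f g : open V ->
  (forall z, V z -> f z = g z) -> smooth_on V f -> smooth_on V g.
Proof.
move=> oV fg sf s y Vy; apply: (regular_at_eq (V := V)) (sf s y Vy) => // z Vz.
exact: (iter_partial_eq (V := V)).
Qed.

Lemma smooth_on_sub V W f : W `<=` V -> smooth_on V f -> smooth_on W f.
Proof. by move=> WV sf s y /WV; exact: sf. Qed.

Lemma smooth_on_local V f :
  (forall y, V y -> exists2 W, W y & smooth_on W f) -> smooth_on V f.
Proof. by move=> loc s y /loc [W Wy]; exact. Qed.

Lemma smooth_on_partial V f i : smooth_on V f -> smooth_on V (partial i f).
Proof. by move=> sf s y Vy; have := sf (rcons s i) y Vy; rewrite /iter_partial foldr_rcons. Qed.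

Lemma smooth_on_is_derive V f i y : smooth_on V f -> V y ->
  is_derive y (delta_mx 0 i : 'rV[R]_p) f (partial i f y).
Proof. by move=> sf /(sf [::]) [_ df]; exact: derivableP. Qed.

Lemma smooth_on_continuous V f y : smooth_on V f -> V y -> {for y, continuous f}.
Proof. by move=> sf /(sf [::]) []. Qed.

(* A class stable under partial derivatives ([smooth_expr_step]), which gives all
   the closure properties of [smooth_on] at once. *)
Inductive smooth_expr V : ('rV[R]_p -> R) -> Prop :=
| smooth_base f : smooth_on V f -> smooth_expr V f
| smooth_cst (k : R) : smooth_expr V (fun=> k)
| smooth_coord i : smooth_expr V (fun y => y 0 i)
| smooth_add f g : smooth_expr V f -> smooth_expr V g -> smooth_expr V (fun y => f y + g y)
| smooth_mul f g : smooth_expr V f -> smooth_expr V g -> smooth_expr V (fun y => f y * g y)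
| smooth_inv f : (forall y, V y -> f y != 0) -> smooth_expr V f ->
    smooth_expr V (fun y => (f y)^-1)
| smooth_ln f : (forall y, V y -> 0 < f y) -> smooth_expr V f ->
    smooth_expr V (fun y => ln (f y))
| smooth_flat n f : smooth_expr V f -> smooth_expr V (fun y => flat n (f y)).

Lemma is_derive_continuous1 (phi : R -> R) (t d : R) :
  is_derive t 1 phi d -> {for t, continuous phi}.
Proof. by case=> /derivable1_diffP /differentiable_continuous. Qed.

Lemma is_derive_inv (t : R) : t != 0 -> is_derive t 1 (fun s : R => s^-1) (- t ^- 2).
Proof.
move=> t0; apply: is_derive_eq; first by apply: derivableP; apply: (derivableV (f := id)).
by rewrite (deriveV (f := id)) // derive_id [_%:A]mulr1.
Qed.

Lemma smooth_expr_step V f : smooth_expr V f ->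
  (forall y, V y -> {for y, continuous f}) /\
  (forall i, exists g, smooth_expr V g /\
     forall y, V y -> is_derive y (delta_mx 0 i : 'rV[R]_p) f (g y)).
Proof.
(* The chain rule, shared by the cases of the inverse, the logarithm and the flat functions: it
   suffices that [dphi (h y)] be again in the class. *)
have comp (phi dphi : R -> R) h : smooth_expr V h ->
    (forall y, V y -> {for y, continuous h}) ->
    (forall i, exists g, smooth_expr V g /\
      forall y, V y -> is_derive y (delta_mx 0 i : 'rV[R]_p) h (g y)) ->
    (forall y, V y -> is_derive (h y) 1 phi (dphi (h y))) ->
    smooth_expr V (fun y => dphi (h y)) ->
    (forall y, V y -> {for y, continuous (fun y => phi (h y))}) /\
    (forall i, exists g, smooth_expr V g /\
     forall y, V y -> is_derive y (delta_mx 0 i : 'rV[R]_p) (fun y => phi (h y)) (g y)).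
  move=> sh ch dh dphiE sd; split=> [y Vy|i].
    apply: (continuous_comp (f := h) (g := phi)); first exact: ch.
    exact: is_derive_continuous1 (dphiE y Vy).
  have [g [sg dg]] := dh i.
  exists (fun y => dphi (h y) * g y); split; first exact: smooth_mul.
  by move=> y Vy; apply: (is_derive_comp (f := h) (phi := phi)); [exact: dg|exact: dphiE].
elim=> {f}.
- move=> f sf; split=> [y|i]; first exact: smooth_on_continuous.
  exists (partial i f); split; first exact/smooth_base/smooth_on_partial.
  by move=> y; exact: smooth_on_is_derive.
- move=> k; split=> [y _|i]; first exact: cst_continuous.
  by exists (fun=> 0); split; [exact: smooth_cst|move=> y _; exact: is_derive_cst].
- move=> j; split=> [y _|i]; first exact: coord_continuous.
  exists (fun=> (delta_mx 0 i : 'rV[R]_p) 0 j); split; first exact: smooth_cst.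
  move=> y _; apply/is_derive_line.
  set k := (X in is_derive _ _ _ X).
  rewrite [X in is_derive _ _ X _](_ : _ = fun h : R => k * h + y 0 j).
    exact: is_derive_affine.
  by apply/funext => h; rewrite /k !mxE mulrC.
- move=> f g sf [cf df] sg [cg dg]; split=> [y Vy|i].
    by apply: continuousD; [exact: cf|exact: cg].
  have [f' [sf' df']] := df i; have [g' [sg' dg']] := dg i.
  exists (fun y => f' y + g' y); split; first exact: smooth_add.
  by move=> y Vy; apply: is_deriveD; [exact: df'|exact: dg'].
- move=> f g sf [cf df] sg [cg dg]; split=> [y Vy|i].
    by apply: continuousM; [exact: cf|exact: cg].
  have [f' [sf' df']] := df i; have [g' [sg' dg']] := dg i.
  exists (fun y => f y * g' y + g y * f' y); split.
    by apply: smooth_add; apply: smooth_mul.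
  by move=> y Vy; apply: is_deriveM; [exact: df'|exact: dg'].
- move=> f f0 sf [cf df]; apply: (comp (fun t => t^-1) (fun t => - t ^- 2)) => //.
    by move=> y Vy; apply: is_derive_inv; exact: f0.
  have sV := smooth_inv f0 sf.
  rewrite [X in smooth_expr _ X](_ : _ = fun y => -1 * ((f y)^-1 * (f y)^-1)).
    by apply: smooth_mul; [exact: smooth_cst|exact: smooth_mul].
  by apply/funext => y; rewrite mulN1r -expr2 exprVn.
- move=> f f0 sf [cf df]; apply: (comp (@ln R) (fun t => t^-1)) => //.
    by move=> y Vy; apply: is_derive1_ln; exact: f0.
  by apply: smooth_inv => // y Vy; rewrite gt_eqF ?f0.
- move=> n f sf [cf df].
  apply: (comp (@flat R n) (fun t => flat n.+2 t - n%:R * flat n.+1 t)) => //.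
    by move=> y Vy; apply: is_derive_flat.
  rewrite [X in smooth_expr _ X](_ : _ = fun y => flat n.+2 (f y) + - n%:R * flat n.+1 (f y)).
    apply: smooth_add; first exact: smooth_flat.
    by apply: smooth_mul; [exact: smooth_cst|exact: smooth_flat].
  by apply/funext => y; rewrite mulNr.
Qed.

(** Induction on the list of derivatives, removing the one applied first: on [V] it agrees with a
    member of the class, and since [V] is open the remaining derivatives agree as well. *)
Lemma smooth_expr_on V f : open V -> smooth_expr V f -> smooth_on V f.
Proof.
move=> oV sf s.
elim/last_ind: s f sf => [|s i IH] f sf y Vy.
  have [cf df] := smooth_expr_step sf; split=> [|i]; first exact: cf.
  by have [h [_ dh]] := df i; have [] := dh y Vy.
have [_ /(_ i)[h [sh dh]]] := smooth_expr_step sf.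
rewrite /iter_partial foldr_rcons; apply: (regular_at_eq (V := V)) (IH h sh y Vy) => // z Vz.
by apply: (iter_partial_eq (V := V)) => // t /dh [].
Qed.

End Smooth.

(** * The mean value theorem along a line *)

Section MeanValue.
Variables (R : realType) (E : normedModType R).

Lemma MVT_line (f df : E -> R) (y v : E) (t : R) :
  (forall s : R, `|s| <= `|t| -> is_derive (s *: v + y) v f (df (s *: v + y))) ->
  exists2 s : R, `|s| <= `|t| & f (t *: v + y) - f y = t * df (s *: v + y).
Proof.
move=> fdf; pose g (h : R) : R := f (h *: v + y); pose dg (h : R) : R := df (h *: v + y).
have gdg (s : R) : `|s| <= `|t| -> is_derive s 1 g (dg s).
  by move=> /fdf; exact: is_derive_shift_line.
have gc (a b : R) : (forall s : R, s \in `[a, b] -> `|s| <= `|t|) -> {within `[a, b], continuous g}.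
  by move=> ab; apply: derivable_within_continuous => s /ab /gdg [].
have g0 : f y = g 0 by rewrite /g scale0r add0r.
rewrite g0 -/(g t); case: (leP 0 t) => t0.
- have h (s : R) : s \in `[0, t] -> `|s| <= `|t|.
    by rewrite in_itv/= => /andP[s0 st]; rewrite !ger0_norm // (le_trans s0).
  have [s sI E0] := MVT_segment t0 (fun x xI => gdg x (h x (subset_itv_oo_cc xI))) (gc _ _ h).
  by exists s; [exact: h|rewrite E0 subr0 mulrC].
- have h (s : R) : s \in `[t, 0] -> `|s| <= `|t|.
    by rewrite in_itv/= => /andP[s0 st]; rewrite !ler0_norm ?lerN2 // ltW.
  have [s sI E0] := MVT_segment (ltW t0) (fun x xI => gdg x (h x (subset_itv_oo_cc xI))) (gc _ _ h).
  by exists s; [exact: h|rewrite -opprB E0 sub0r mulrN opprK mulrC].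
Qed.

End MeanValue.

(** * The chain rule along curves and the symmetry of second derivatives *)

Section Calculus.
Variables (R : realType) (p : nat).
Implicit Types (V W : set 'rV[R]_p) (f g : 'rV[R]_p -> R) (y : 'rV[R]_p).
Local Notation e_ i := (delta_mx 0 i : 'rV[R]_p).

Lemma norm_coord (u : 'rV[R]_p) i : `|u 0 i| <= `|u|.
Proof. by rewrite [leRHS]/Num.Def.normr/= mx_normrE; exact: (le_bigmax _ _ (0, i)). Qed.

Lemma norm_rV_le (u : 'rV[R]_p) (r : R) : 0 <= r ->
  (forall i, `|u 0 i| <= r) -> `|u| <= r.
Proof.
move=> r0 ur; rewrite [leLHS]/Num.Def.normr/= mx_normrE bigmax_le // => -[a i] _.
by rewrite (ord1 a).
Qed.

Lemma near_ball V y : open V -> V y ->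
  exists2 r : R, 0 < r & forall u : 'rV[R]_p, `|u| < r -> V (u + y).
Proof.
move=> oV Vy; have /nbhs_ballP[r r0 rV] := open_nbhs_nbhs (conj oV Vy).
exists r => // u ur; apply: rV; rewrite -ball_normE /=.
by rewrite opprD addrCA subrr addr0 normrN.
Qed.

(** The mean value theorem is applied on each edge of a staircase from [y] to [u + y]. For the sup
    norm, the staircase stays within distance [|u|] of [y]. *)
Lemma smooth_on_mean_value V f y (u : 'rV[R]_p) : smooth_on V f ->
  (forall w : 'rV[R]_p, `|w| <= `|u| -> V (w + y)) ->
  exists xi : 'I_p -> 'rV[R]_p, (forall k, `|xi k| <= `|u|) /\
    f (u + y) - f y = \sum_k u 0 k * partial k f (xi k + y).
Proof.
move=> sf uV.
(* Corners of the staircase: the first [m] coordinates of [u] followed by zeros, so that consecutive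
   corners differ along one axis. *)
pose z (m : nat) : 'rV[R]_p := \row_k (if (k < m)%N then u 0 k else 0).
have zS (k : 'I_p) : z k.+1 = u 0 k *: e_ k + z k.
  apply/rowP => l; rewrite !mxE ltnS /=.
  rewrite -val_eqE /=; case: (ltngtP l k) => [lk|kl|/val_inj->].
  - by rewrite mulr0 add0r.
  - by rewrite mulr0 add0r.
  - by rewrite mulr1 addr0.
have zle m (s : R) (k : 'I_p) : (m <= k)%N -> `|s| <= `|u 0 k| -> `|s *: e_ k + z m| <= `|u|.
  move=> mk su; apply: norm_rV_le => // l; rewrite !mxE /=.
  case: eqP => [->|_].
    by rewrite mulr1 ltnNge mk /= addr0 (le_trans su) // norm_coord.
  by rewrite mulr0 add0r; case: ifP => _; rewrite ?normr0 // norm_coord.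
have step (k : 'I_p) : exists xi : 'rV[R]_p, `|xi| <= `|u| /\
    f (z k.+1 + y) - f (z k + y) = u 0 k * partial k f (xi + y).
  have [s su E] := @MVT_line R _ f (partial k f) (z k + y) (e_ k) (u 0 k)
    (fun s su => smooth_on_is_derive k sf (eq_ind_r V (uV _ (zle k s k (leqnn k) su)) (addrA _ _ _))).
  by exists (s *: e_ k + z k); split; [exact: zle|rewrite zS -!addrA].
have [xi xiP] := choice step; exists xi; split=> [k|]; first by have [] := xiP k.
have zp : z p = u by apply/rowP => k; rewrite mxE ltn_ord.
have z0 : z 0 = 0 by apply/rowP => k; rewrite !mxE.
rewrite -[in LHS]zp -[y in X in _ - X]add0r -z0 -(telescope_sumr (fun m => f (z m + y))) //.
by rewrite big_mkord; apply: eq_bigr => k _; have [_ ->] := xiP k.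
Qed.

(** The increment of [g] is expanded by the mean value formula; the intermediate points tend to
    [c 0], and the partial derivatives are continuous there. *)
Lemma is_derive_along_curve V g (c : R -> 'rV[R]_p) (d : 'I_p -> R) :
  open V -> smooth_on V g -> V (c 0) ->
  (forall k, is_derive (0 : R) 1 (fun h => c h 0 k) (d k)) ->
  is_derive (0 : R) 1 (g \o c) (\sum_k d k * partial k g (c 0)).
Proof.
move=> oV sg Vc dc.
have cc : {for 0, continuous c}.
  have /derivable_mxP : forall i j, derivable (fun h => c h i j) 0 1.
    by move=> i j; rewrite (ord1 i); exact: ex_derive.
  by move=> /derivable1_diffP /differentiable_continuous.
have [r r0 rV] := near_ball oV Vc.
(* When [c h] leaves the ball the intermediate points get the default value 0; the limit only
   involves small [h]. *)
have ex h : exists xi : 'I_p -> 'rV[R]_p, `|c h - c 0| < r ->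
    (forall k, `|xi k| <= `|c h - c 0|) /\
    g (c h) - g (c 0) = \sum_k (c h 0 k - c 0 0 k) * partial k g (xi k + c 0).
  case: (ltP `|c h - c 0| r) => [hr|]; last by exists (fun=> 0).
  have [|xi [xiu E]] := @smooth_on_mean_value V g (c 0) (c h - c 0) sg.
    by move=> w wr; apply: rV; exact: le_lt_trans wr hr.
  exists xi => _; split=> //; rewrite -[c h in LHS](subrK (c 0)) E.
  by apply: eq_bigr => k _; rewrite !mxE.
have [xi xiP] := choice ex.
have near_c (e : R) : 0 < e -> \forall h \near (0 : R), `|c h - c 0| < e.
  by move=> e0; move/cvgrPdist_lt : cc => /(_ e e0); apply: filterS => h; rewrite distrC.
have cvg_xi k : partial k g (xi h k + c 0) @[h --> (0 : R)^'] --> partial k g (c 0).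
  have cpg := smooth_on_continuous (smooth_on_partial k sg) Vc.
  apply: (cvg_comp (fun h => xi h k + c 0) (partial k g) (G := nbhs (c 0))) cpg.
  apply/cvgrPdist_lt => e e0; apply: cvg_within.
  apply: filterS2 (near_c _ e0) (near_c _ r0) => h he hr.
  by rewrite opprD addrCA subrr addr0 normrN (le_lt_trans _ he) //; have [] := xiP h hr.
have lim : h^-1 *: ((g \o c) (h *: 1 + 0) - (g \o c) 0) @[h --> (0 : R)^'] -->
    \sum_k d k * partial k g (c 0).
  apply: (@cvg_trans _ ((\sum_k (h^-1 *: (c (h *: 1 + 0) 0 k - c 0 0 k)) *
     partial k g (xi h k + c 0)) @[h --> (0 : R)^'])).
    apply: near_eq_cvg; apply: cvg_within; apply: filterS (near_c _ r0) => h hr.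
    rewrite /= addr0 [_%:A]mulr1; have [_ ->] := xiP h hr.
    by rewrite scaler_sumr; apply: eq_bigr => k _; rewrite scalerAl.
  apply: cvg_big => [|k _]; first exact: add_continuous.
  apply: cvgM; last exact: cvg_xi.
  have [dk <-] := dc k; exact: dk.
by split; [apply/cvg_ex; eexists; exact: lim|exact: cvg_lim].
Qed.

Lemma is_derive_translate f (w y v : 'rV[R]_p) d :
  is_derive (w + y) v f d -> is_derive y v (fun z => f (w + z)) d.
Proof.
move=> /is_derive_line fd; apply/is_derive_line.
rewrite [X in is_derive _ _ X _](_ : _ = fun h : R => f (h *: v + (w + y))) //.
by apply/funext => h; rewrite addrCA.
Qed.

Lemma norm_scale_delta (s : R) k : `|s *: e_ k| <= `|s|.
Proof.
apply: norm_rV_le => // i; rewrite !mxE /=.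
by case: eqP => _; rewrite ?mulr1 // mulr0 normr0.
Qed.

(** Two applications of the mean value theorem: along [e_ k] to the increment of [f] in the
    direction [e_ l], then along [e_ l] to [partial k f]. *)
Lemma second_difference V f y (r t : R) (k l : 'I_p) : smooth_on V f ->
  (forall u : 'rV[R]_p, `|u| < r -> V (u + y)) -> 0 < t -> t + t < r ->
  exists u : 'rV[R]_p, `|u| < r /\
    f (t *: e_ l + (t *: e_ k + y)) - f (t *: e_ k + y) - (f (t *: e_ l + y) - f y) =
    t * (t * partial l (partial k f) (u + y)).
Proof.
move=> sf rV t0 tr; have tE : `|t| = t by rewrite gtr0_norm.
have small (s s' : R) : `|s| <= `|t| -> `|s'| <= `|t| -> `|s' *: e_ l + s *: e_ k| < r.
  rewrite tE => st st'; apply: le_lt_trans tr; apply: le_trans (ler_normD _ _) _.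
  by apply: lerD; [apply: le_trans (norm_scale_delta s' l) _|apply: le_trans (norm_scale_delta s k) _].
have V2 (s s' : R) : `|s| <= `|t| -> `|s'| <= `|t| -> V (s' *: e_ l + (s *: e_ k + y)).
  by move=> st st'; rewrite addrA; apply: rV; exact: small.
pose phi z := f (t *: e_ l + z) - f z.
pose dphi z := partial k f (t *: e_ l + z) - partial k f z.
have [s st ->] : exists2 s : R, `|s| <= `|t| & phi (t *: e_ k + y) - phi y = t * dphi (s *: e_ k + y).
  apply: MVT_line => s st; apply: is_deriveB.
    by apply: is_derive_translate; apply: smooth_on_is_derive sf _; exact: V2.
  apply: smooth_on_is_derive sf _; have := V2 s 0 st; rewrite scale0r add0r; apply.
  by rewrite normr0.
rewrite /dphi; have [s' st' ->] := @MVT_line R _ (partial k f) (partial l (partial k f)) (s *: e_ k + y) (e_ l) t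
  (fun s' st' => smooth_on_is_derive l (smooth_on_partial k sf) (V2 s s' st st')).
by exists (s' *: e_ l + s *: e_ k); split; [exact: small|rewrite addrA].
Qed.

Lemma continuous_eq_near (g h : 'rV[R]_p -> R) y :
  {for y, continuous g} -> {for y, continuous h} ->
  (forall r : R, 0 < r -> exists u w : 'rV[R]_p,
     [/\ `|u| < r, `|w| < r & g (u + y) = h (w + y)]) ->
  g y = h y.
Proof.
move=> /cvgrPdist_lt cg /cvgrPdist_lt ch gh.
apply/eqP; rewrite -subr_eq0 -normr_eq0; apply: contraT => ab.
have e0 : 0 < `|g y - h y| / 2 by rewrite divr_gt0 // lt_def ab normr_ge0.
have [r r0 rN] : exists2 r : R, 0 < r & forall u : 'rV[R]_p, `|u| < r ->
    `|g y - g (u + y)| < `|g y - h y| / 2 /\ `|h y - h (u + y)| < `|g y - h y| / 2.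
  have : \forall z \near y, `|g y - g z| < `|g y - h y| / 2 /\ `|h y - h z| < `|g y - h y| / 2.
    exact: filterI (cg _ e0) (ch _ e0).
  move=> /nbhs_ballP[r r0 rV].
  exists r => // u ur; apply: rV; rewrite -ball_normE /=.
  by rewrite opprD addrCA subrr addr0 normrN.
have [u [w [/rN[gu _] /rN[_ +] E]]] := gh r r0.
rewrite -E distrC => gw.
have := ler_normD (g y - g (u + y)) (g (u + y) - h y); rewrite subrKA.
by move: gu gw; lra.
Qed.

(** The second difference is symmetric in the two directions, so the two mixed derivatives take a
    common value at points arbitrarily close to [y]; continuity concludes. *)
Lemma partial_comm V f i j y : open V -> V y -> smooth_on V f ->
  partial i (partial j f) y = partial j (partial i f) y.
Proof.
move=> oV Vy sf; have [r0 r00 rV] := near_ball oV Vy.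
apply: continuous_eq_near.
- exact: smooth_on_continuous (smooth_on_partial i (smooth_on_partial j sf)) Vy.
- exact: smooth_on_continuous (smooth_on_partial j (smooth_on_partial i sf)) Vy.
move=> r1 r10; pose r := Num.min r0 r1.
have rr0 : 0 < r by rewrite lt_min r00.
have {}rV u : `|u| < r -> V (u + y) by rewrite lt_min => /andP[/rV].
pose t := r / 4; have t0 : 0 < t by rewrite divr_gt0.
have tr : t + t < r by rewrite /t; lra.
have [u [ur E]] := second_difference j i sf rV t0 tr.
have [w [wr E']] := second_difference i j sf rV t0 tr.
have lt_r1 (x : 'rV[R]_p) : `|x| < r -> `|x| < r1 by rewrite lt_min => /andP[].
exists u, w; split; [exact: lt_r1|exact: lt_r1|].
apply: (mulfI (lt0r_neq0 t0)); apply: (mulfI (lt0r_neq0 t0)).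
have sym (a b c d x x' : R) : a - b - (c - d) = x -> a - c - (b - d) = x' -> x = x'.
  by move=> <- <-; ring.
by apply: sym E _; rewrite addrCA; exact: E'.
Qed.

End Calculus.

(** * Smooth bump functions with compact support *)

Section Bump.
Variables (R : realType) (p : nat).
Implicit Types (V : set 'rV[R]_p) (y : 'rV[R]_p).

Lemma smooth_expr_sum V (I : Type) (s : seq I) (F : I -> 'rV[R]_p -> R) :
  (forall i, smooth_expr V (F i)) -> smooth_expr V (fun y => \sum_(i <- s) F i y).
Proof.
move=> sF; elim: s => [|i s IH].
  by under eq_fun do rewrite big_nil; exact: smooth_cst.
by under eq_fun do rewrite big_cons; exact: smooth_add.
Qed.

Lemma smooth_expr_prod V (I : Type) (s : seq I) (F : I -> 'rV[R]_p -> R) :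
  (forall i, smooth_expr V (F i)) -> smooth_expr V (fun y => \prod_(i <- s) F i y).
Proof.
move=> sF; elim: s => [|i s IH].
  by under eq_fun do rewrite big_nil; exact: smooth_cst.
by under eq_fun do rewrite big_cons; exact: smooth_mul.
Qed.

Definition step (t : R) : R := flat 0 t * (flat 0 t + flat 0 (1 - t))^-1.

Lemma step_den_gt0 (t : R) : 0 < flat 0 t + flat 0 (1 - t).
Proof.
case: (ltP 0 t) => t0; first by rewrite ltr_pwDl ?flat_gt0 ?flat_ge0.
by rewrite ltr_wpDl ?flat_ge0 // flat_gt0; lra.
Qed.

Lemma step0 (t : R) : t <= 0 -> step t = 0.
Proof. by move=> t0; rewrite /step (flat_le0 _ t0) mul0r. Qed.

Lemma step1 (t : R) : 1 <= t -> step t = 1.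
Proof.
move=> t1; rewrite /step (@flat_le0 _ _ (1 - t)) ?subr_le0 // addr0 mulfV //.
by rewrite gt_eqF // flat_gt0 // (lt_le_trans _ t1).
Qed.

Lemma smooth_step V f : smooth_expr V f -> smooth_expr V (fun y => step (f y)).
Proof.
move=> sf; apply: smooth_mul; first exact: smooth_flat.
apply: smooth_inv => [y _|]; first by rewrite gt_eqF // step_den_gt0.
apply: smooth_add; first exact: smooth_flat.
apply: smooth_flat; apply: smooth_add; first exact: smooth_cst.
rewrite [X in smooth_expr _ X](_ : _ = fun y => -1 * f y).
  by apply: smooth_mul => //; exact: smooth_cst.
by apply/funext => y; rewrite mulN1r.
Qed.

Lemma bump_function V y : open V -> V y ->
  exists chi : 'rV[R]_p -> R, exists K N : set 'rV[R]_p,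
  [/\ smooth_on setT chi, compact K, K `<=` V, (open N /\ N y) &
      (forall z, N z -> chi z = 1) /\ (forall z, ~ K z -> chi z = 0)].
Proof.
move=> oV Vy; have [r0 r00 rV] := near_ball oV Vy.
(* The support lies in the closed ball of radius [2 * r], hence in [V]. The argument of [step] is at
   least 1 when [|z_k - y_k| <= r] and at most 0 when [|z_k - y_k| >= 2 * r]. *)
pose r : R := r0 / 4; have r_gt0 : 0 < r by rewrite divr_gt0.
pose chi (z : 'rV[R]_p) := \prod_(k < p) step (2 - (z 0 k - y 0 k) ^+ 2 / r ^+ 2).
exists chi, [set z | `|y - z| <= 2 * r], (ball y r); split.
- apply: smooth_expr_on; first exact: openT.
  apply: smooth_expr_prod => k; apply: smooth_step.
  rewrite [X in smooth_expr _ X](_ : _ = fun z : 'rV[R]_p => 2 + - r ^- 2 * ((z 0 k + - y 0 k) * (z 0 k + - y 0 k))).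
    apply: smooth_add; first exact: smooth_cst.
    apply: smooth_mul; first exact: smooth_cst.
    by apply: smooth_mul; apply: smooth_add; [exact: smooth_coord|exact: smooth_cst|
      exact: smooth_coord|exact: smooth_cst].
  by apply/funext => z; rewrite expr2 mulNr [r ^- 2 * _]mulrC.
- apply: bounded_closed_compact; last exact: closed_closed_ball_.
  exists (`|y| + 2 * r); split; first exact: num_real.
  move=> x xr z /= zr; apply: le_trans (ltW xr).
  rewrite -[z](subKr y) (le_trans (ler_normB _ _)) // lerD2l //.
- move=> z /= zr; rewrite -[z](subrK y); apply: rV.
  by rewrite distrC (le_lt_trans zr) // /r; lra.
- by split; [exact: ball_open|exact: ballxx].
split=> z.
  rewrite -ball_normE /= => zr; apply: big1 => k _; apply: step1.
  have : `|z 0 k - y 0 k| <= r.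
    have := norm_coord (z - y) k; rewrite !mxE distrC => /le_trans -> //.
    by rewrite distrC ltW.
  move=> zk; have : (z 0 k - y 0 k) ^+ 2 <= r ^+ 2.
    by rewrite -[leLHS]real_normK ?num_real // ler_pXn2r ?nnegrE // ltW.
  by rewrite -[r ^+ 2]mul1r -ler_pdivrMr ?exprn_gt0 //; lra.
move=> /= /negP; rewrite -ltNge => zr.
have [k kr] : exists k, r * 2 < `|z 0 k - y 0 k|.
  apply: contrapT => nk; move: zr; rewrite ltNge => /negP; apply.
  apply: norm_rV_le => [|k]; first by rewrite mulr_ge0 // ltW.
  rewrite leNgt; apply/negP => kr; apply: nk; exists k; move: kr.
  by rewrite !mxE distrC mulrC.
rewrite /chi (bigD1 k) //= step0 ?mul0r //.
rewrite subr_le0 ler_pdivlMr ?exprn_gt0 // -[leRHS]real_normK ?num_real //.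
have : (r * 2) ^+ 2 <= `|z 0 k - y 0 k| ^+ 2.
  by move: kr r_gt0; move: (r) => r' kr r0'; apply: lerXn2r;
    rewrite ?nnegrE ?normr_ge0 ?mulr_ge0 // ltW.
by move: (r) => r'; apply: le_trans; have := sqr_ge0 r'; rewrite !expr2; lra.
Qed.

End Bump.

(** * Super-derivations and the Lie derivative of an even 1-form *)

(* Equalities in commutative groups by reflection: [ring] does not apply to
   super-algebras, which are neither commutative nor known to be nontrivial. *)
Inductive zmod_expr := ZVar of nat | ZZero | ZAdd of zmod_expr & zmod_expr | ZOpp of zmod_expr.

Fixpoint zmod_eval (V : zmodType) (env : seq V) e : V :=
  match e with
  | ZVar n => nth 0 env n
  | ZZero => 0
  | ZAdd e1 e2 => zmod_eval env e1 + zmod_eval env e2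
  | ZOpp e1 => - zmod_eval env e1
  end.

Fixpoint zmod_coef e (i : nat) : int :=
  match e with
  | ZVar n => (n == i)%:Z
  | ZZero => 0
  | ZAdd e1 e2 => zmod_coef e1 i + zmod_coef e2 i
  | ZOpp e1 => - zmod_coef e1 i
  end.

Lemma zmod_evalE (V : zmodType) (env : seq V) e :
  zmod_eval env e = \sum_(i < size env) nth 0 env i *~ zmod_coef e i.
Proof.
elim: e => [n||e1 IH1 e2 IH2|e IH] /=.
- case: (ltnP n (size env)) => n_lt.
    rewrite (bigD1 (Ordinal n_lt)) //= eqxx big1 ?addr0 // => i /negbTE.
    by rewrite -val_eqE /= eq_sym => ->.
  rewrite nth_default // big1 // => i _.
  by rewrite gtn_eqF // (leq_trans (ltn_ord i)).
- by rewrite big1.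
- by rewrite IH1 IH2 -big_split; apply: eq_bigr => i _; rewrite mulrzDr.
- by rewrite IH -sumrN; apply: eq_bigr => i _; rewrite mulrNz.
Qed.

Lemma zmod_eval_eq (V : zmodType) (env : seq V) e1 e2 :
  all (fun i => zmod_coef e1 i == zmod_coef e2 i) (iota 0 (size env)) ->
  zmod_eval env e1 = zmod_eval env e2.
Proof.
move=> /allP e12; rewrite !zmod_evalE; apply: eq_bigr => i _.
by rewrite (eqP (e12 i _)) // mem_iota /=.
Qed.

Ltac zmod_index x l :=
  match l with
  | ?y :: _ => let _ := match goal with _ => unify x y end in constr:(0%N)
  | _ :: ?t => let n := zmod_index x t in constr:(n.+1)
  end.

Ltac zmod_atoms l t :=
  lazymatch t with
  | ?a + ?b => let l := zmod_atoms l a in zmod_atoms l b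
  | - ?a => zmod_atoms l a
  | 0 => l
  | _ => match l with
         | _ => let n := zmod_index t l in l
         | _ => constr:(t :: l)
         end
  end.

Ltac zmod_reify l t :=
  lazymatch t with
  | ?a + ?b => let a := zmod_reify l a in let b := zmod_reify l b in constr:(ZAdd a b)
  | - ?a => let a := zmod_reify l a in constr:(ZOpp a)
  | 0 => constr:(ZZero)
  | _ => let n := zmod_index t l in constr:(ZVar n)
  end.

Ltac zmod :=
  lazymatch goal with
  | |- @eq ?T ?a ?b =>
    let l := zmod_atoms (@nil T) a in
    let l := zmod_atoms l b in
    let ea := zmod_reify l a in
    let eb := zmod_reify l b in
    exact: (@zmod_eval_eq _ l ea eb isT)
  end.

(** * Parity, homogeneous super-derivations and super-commutators *)

Section SuperAlgebra.
Variables (R : pzRingType) (A : superAlgType R).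
Implicit Types (X Y Z : A -> A) (f g : A) (b c : bool).

Lemma hpart0 b : hpart b (0 : A) = 0.
Proof. by apply: (addrI (hpart b 0)); rewrite -hpartD !addr0. Qed.

Lemma hpartN b f : hpart b (- f) = - hpart b f.
Proof. by apply: (addrI (hpart b f)); rewrite -hpartD !subrr hpart0. Qed.

Lemma homog_hpart b f : homog b (hpart b f).
Proof. by rewrite /homog hpart_hpart eqxx. Qed.

Lemma homog0 b : homog b (0 : A).
Proof. exact: hpart0. Qed.

Lemma homogD b f g : homog b f -> homog b g -> homog b (f + g).
Proof. by rewrite /homog hpartD => -> ->. Qed.

Lemma homogN b f : homog b f -> homog b (- f).
Proof. by rewrite /homog hpartN => ->. Qed.

Lemma homogM b c f g : homog b f -> homog c g -> homog (b (+) c) (f * g).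
Proof. by rewrite /homog => <- <-; exact: hpartM. Qed.

Lemma homog_signM b c f : homog b f -> homog b ((-1) ^+ c * f).
Proof. by case: c => bf; rewrite ?expr0 ?mul1r // expr1 mulN1r; exact: homogN. Qed.

Lemma hpart_homog b c f : homog b f -> hpart c f = if c == b then f else 0.
Proof. by rewrite /homog => <-; rewrite hpart_hpart; case: eqP. Qed.

Lemma hpart_sumb b f : hpart b f + hpart (~~ b) f = f.
Proof. by case: b; rewrite /= ?hpart_sum // addrC hpart_sum. Qed.

(** Comparing parities in [f = f * 1] shows that the odd part of 1 is annihilated by every
    homogeneous [f]. Applied to the two components of 1, this makes the odd part of 1 vanish. *)
Lemma homog1 : homog false (1 : A).
Proof.
have h1 b f : homog b f -> f * hpart true 1 = 0.
  move=> bf; have : hpart (~~ b) f = 0 by rewrite (hpart_homog _ bf); case: (b).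
  have E : f = f * hpart false 1 + f * hpart true 1.
    by rewrite -mulrDr (hpart_sumb false) mulr1.
  rewrite {1}E hpartD.
  have o1 := homogM bf (homog_hpart true 1); have e1 := homogM bf (homog_hpart false 1).
  rewrite (hpart_homog _ o1) (hpart_homog _ e1) /=.
  by case: b {bf o1 e1}; rewrite /= ?add0r.
have : hpart true (1 : A) = 0.
  have -> : hpart true (1 : A) = hpart false 1 * hpart true 1 + hpart true 1 * hpart true 1.
    by rewrite -mulrDl (hpart_sumb false) mul1r.
  by rewrite !(h1 _ _ (homog_hpart _ _)) addr0.
by move=> h; have := hpart_sum (1 : A); rewrite h addr0.
Qed.

Definition additive_map X := forall f g, X (f + g) = X f + X g.

Lemma additive_map0 X : additive_map X -> X 0 = 0.
Proof. by move=> aX; apply: (addrI (X 0)); rewrite -aX !addr0. Qed.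

Lemma additive_mapN X f : additive_map X -> X (- f) = - X f.
Proof. by move=> aX; apply: (addrI (X f)); rewrite -aX !subrr additive_map0. Qed.

Lemma additive_mapB X f g : additive_map X -> X (f - g) = X f - X g.
Proof. by move=> aX; rewrite aX additive_mapN. Qed.

Lemma vpart_sum X f : additive_map X -> vpart false X f + vpart true X f = X f.
Proof.
move=> aX; rewrite /vpart -{5}(hpart_sum f) aX.
by rewrite -(hpart_sumb false (X (hpart false f))) -(hpart_sumb false (X (hpart true f))) !hpartD
   !hpart_hpart /=; zmod.
Qed.

Lemma vpart_homog b c X f : homog c f -> additive_map X ->
  vpart b X f = hpart (b (+) c) (X f).
Proof.
move=> cf aX; rewrite /vpart !(hpart_homog _ cf).
by case: c cf => cf /=; rewrite (additive_map0 aX) hpart0 ?add0r ?addr0 ?addbF ?addbT.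
Qed.

(** The homogeneous super-vector fields of parity [b]; the components of an element of [Vect] are of
    this kind, and sign computations are done on them. *)
Definition sder b X := [/\
  forall (k : R) f g, X (scal k * f + g) = scal k * X f + X g,
  forall c f, homog c f -> homog (b (+) c) (X f) &
  forall c f g, homog c f -> X (f * g) = X f * g + (-1) ^+ (b && c) * (f * X g)].

Lemma linear_additive X :
  (forall (k : R) f g, X (scal k * f + g) = scal k * X f + X g) -> additive_map X.
Proof. by move=> lX f g; have := lX 1 f g; rewrite !scal_one !mul1r. Qed.

Lemma sder_additive b X : sder b X -> additive_map X.
Proof. by case=> /linear_additive. Qed.

Lemma Vect_additive X : Vect X -> additive_map X.
Proof. by case=> /linear_additive. Qed.

Lemma additive_map_ext X Y : additive_map X -> additive_map Y ->
  (forall c f, homog c f -> X f = Y f) -> X = Y.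
Proof.
move=> aX aY XY; apply/funext => f; rewrite -(hpart_sum f) aX aY.
by congr (_ + _); apply: XY (homog_hpart _ _).
Qed.

Lemma vpart_additive b X : additive_map X -> additive_map (vpart b X).
Proof. by move=> aX f g; rewrite /vpart !hpartD !aX !hpartD; zmod. Qed.

Lemma vpart_sder b X : sder b X -> vpart b X = X.
Proof.
move=> sX; have aX := sder_additive sX; case: sX => _ pX _.
apply: (additive_map_ext (vpart_additive b aX) aX) => c f cf.
by rewrite (vpart_homog b cf aX); exact: pX.
Qed.

Lemma vpart_sder_neg b X : sder b X -> vpart (~~ b) X = fun=> 0.
Proof.
move=> sX; have aX := sder_additive sX; case: sX => _ pX _.
apply: (additive_map_ext (vpart_additive _ aX)) => [f g|c f cf]; first by rewrite addr0.
by rewrite (vpart_homog _ cf aX) (hpart_homog _ (pX c f cf)); case: (b); case: (c).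
Qed.

Lemma sder_Vect b X : sder b X -> Vect X.
Proof.
move=> sX; split=> [|d c f g cf]; first by case: sX.
have [->|] := eqVneq d b; first by rewrite (vpart_sder sX); case: sX => _ _; apply.
have [->|->] : d = b \/ d = ~~ b by case: (d); case: (b); auto.
  by rewrite eqxx.
by move=> _; rewrite (vpart_sder_neg sX) mul0r !mulr0 addr0.
Qed.

Lemma Vect_sder b X : Vect X -> sder b (vpart b X).
Proof.
move=> [lX dX]; have aX := linear_additive lX; split=> [k f g|c f cf|c f g cf]; last exact: dX.
  rewrite /vpart !hpartD !hpart_scal !lX !hpartD !hpart_scal !mulrDr. zmod.
by rewrite (vpart_homog b cf aX); exact: homog_hpart.
Qed.

Lemma Vect_vpart b X : Vect X -> Vect (vpart b X).
Proof. by move=> /(Vect_sder b) /sder_Vect. Qed.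

Lemma sder_0 b : sder b (fun=> 0).
Proof.
split=> [k f g|c f _|c f g _]; first by rewrite mulr0 addr0.
  exact: homog0.
by rewrite mul0r !mulr0 addr0.
Qed.

Lemma sder_add b X Y : sder b X -> sder b Y -> sder b (fun f => X f + Y f).
Proof.
move=> [lX pX dX] [lY pY dY]; split=> [k f g|c f cf|c f g cf].
- by rewrite lX lY mulrDr; zmod.
- by apply: homogD; [exact: pX|exact: pY].
- by rewrite (dX _ _ _ cf) (dY _ _ _ cf) mulrDl !mulrDr; zmod.
Qed.

(** The bracket of homogeneous fields, with the parities given explicitly so that no decomposition
    into components is needed. *)
Definition scomm b c X Y : A -> A := fun f => X (Y f) - (-1) ^+ (b && c) * Y (X f).

Lemma scomm_even b X Y f : scomm b false X Y f = X (Y f) - Y (X f).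
Proof. by rewrite /scomm andbF expr0 mul1r. Qed.

Lemma sder_signM b c X f : sder b X -> X ((-1) ^+ c * f) = (-1) ^+ c * X f.
Proof.
move=> /sder_additive aX; case: c; rewrite ?expr0 ?mul1r // expr1 !mulN1r.
exact: additive_mapN.
Qed.

Lemma sder_scomm b c X Y : sder b X -> sder c Y -> sder (b (+) c) (scomm b c X Y).
Proof.
move=> sX sY; have aX := sder_additive sX; have aY := sder_additive sY.
case: (sX) => lX pX dX; case: (sY) => lY pY dY; split=> [k f g|d f df|d f g df].
- rewrite /scomm lY lX lX lY.
  by case: (b && c); rewrite ?expr0 ?expr1 ?mul1r ?mulN1r !mulrDr ?mulrN; zmod.
- apply: homogD; first by rewrite -addbA; apply/pX/pY.
  by apply/homogN/homog_signM; rewrite (addbC b) -addbA; apply/pY/pX.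
- rewrite /scomm (dY _ _ _ df) (dX _ _ _ df) aX aY.
  rewrite !(sder_signM _ _ sX) !(sder_signM _ _ sY).
  rewrite (dX _ _ _ (pY _ _ df)) (dY _ _ _ (pX _ _ df)) (dX _ _ _ df) (dY _ _ _ df).
  clear; case: b; case: c; case: d.
  all: rewrite /= ?expr0 ?expr1 ?mul1r ?mulN1r ?opprK !mulrDr ?mulrN ?mulrDl ?mulNr.
  all: zmod.
Qed.

Lemma bracketE b c X Y : sder b X -> sder c Y -> bracket X Y = scomm b c X Y.
Proof.
move=> sX sY; apply/funext => f; rewrite /bracket /scomm !big_bool /=.
have [X0 Y0] := (vpart_sder_neg sX, vpart_sder_neg sY).
have [aX aY] := (sder_additive sX, sder_additive sY).
have [eX eY] := (vpart_sder sX, vpart_sder sY).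
case: b sX X0 eX => sX /= -> ->; case: c sY Y0 eY => sY /= -> ->.
all: by rewrite ?(additive_map0 aX) ?(additive_map0 aY) ?mulr0 ?subr0 ?addr0 ?add0r.
Qed.

Lemma sder_eq b c X : b = c -> sder b X -> sder c X.
Proof. by move=> ->. Qed.

Lemma sder1 b X : sder b X -> X 1 = 0.
Proof.
move=> [_ _ dX]; have := dX false 1 1 homog1.
rewrite andbF expr0 !mul1r mulr1 => E.
by apply: (addrI (X 1)); rewrite addr0 -E.
Qed.

(** * The Lie derivative of an even 1-form in terms of homogeneous components *)

Section Forms.
Variable w : (A -> A) -> A.
Hypotheses (lw : form_linear w) (ew : form_even w).

Lemma form0 : w (fun=> 0) = 0.
Proof.
have V0 : Vect (fun=> 0 : A) := sder_Vect (sder_0 false).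
apply: (addrI (w (fun=> 0))); rewrite addr0 -lw.1 //.
by congr w; apply/funext => f; rewrite addr0.
Qed.

Lemma form_homog b Y : sder b Y -> homog (~~ b) (w Y).
Proof. by move=> sY; apply: ew; [exact: sder_Vect sY|exact: vpart_sder]. Qed.

Lemma form_vpart Y : Vect Y -> w Y = w (vpart false Y) + w (vpart true Y).
Proof.
move=> VY; rewrite -lw.1; try exact: Vect_vpart.
by congr w; apply/funext => f; rewrite vpart_sum //; exact: Vect_additive.
Qed.

(** An even form shifts parity and 1 is even, so only the odd component of [X] contributes to
    [w X]. *)
Lemma form_eq1 X : Vect X -> w X = 1 -> w (vpart false X) = 0 /\ w (vpart true X) = 1.
Proof.
move=> VX wX.
have h b := form_homog (Vect_sder b VX).
have := form_vpart VX; rewrite wX => E.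
split.
  have := congr1 (hpart true) E.
  by rewrite hpartD (hpart_homog _ homog1) (hpart_homog _ (h false)) (hpart_homog _ (h true)) /= addr0.
have := congr1 (hpart false) E.
by rewrite hpartD (hpart_homog _ homog1) (hpart_homog _ (h false)) (hpart_homog _ (h true)) /= add0r.
Qed.

(* Up to sign, the contraction with [Y] of the Lie derivative of [w] along [X]. *)
Definition lie_term b c X Y : A := X (w Y) - w (scomm b c X Y).

Lemma lie_term_homog b c X Y : sder b X -> sder c Y ->
  homog (~~ (b (+) c)) (lie_term b c X Y).
Proof.
move=> sX sY; apply: homogD.
  by rewrite -addbN; case: sX => _ pX _; apply/pX/form_homog.
exact/homogN/form_homog/sder_scomm.
Qed.

(** The hypothesis removes the derivative of [w X] from the Cartan formula; what remains is the Lie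
    term of each component of [Y], with its sign. *)
Lemma d1_sder b X Y : sder b X -> Vect Y -> (forall c, vpart c Y (w X) = 0) ->
  d1 w X Y = \sum_(c : bool) (-1) ^+ (b && ~~ c) * lie_term b c X (vpart c Y).
Proof.
move=> sX VY YX; rewrite /d1 /lie_term.
have sY c := Vect_sder c VY.
rewrite (bigD1 b) //= [X in _ + X]big1 ?addr0 => [|b' b'b].
  by apply: eq_bigr => c _; rewrite (vpart_sder sX) YX mulr0 subr0 (bracketE sX (sY c)).
apply: big1 => c _; have -> : b' = ~~ b by case: (b') b'b; case: (b).
rewrite (vpart_sder_neg sX) (bracketE (sder_0 b) (sY c)) form0.
have Y0 := additive_map0 (sder_additive (sY c)); rewrite Y0 mulr0 subr0.
have -> : scomm b c (fun=> 0) (vpart c Y) = fun=> 0.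
  by apply/funext => f; rewrite /scomm Y0 mulr0 subr0.
by rewrite form0 subr0 mulr0.
Qed.

(** The contractions of [w] with the components of [X] are the constants 0 and 1, so every
    derivative of them vanishes. *)
Lemma lie_derivativeE X Y : Vect X -> w X = 1 -> Vect Y ->
  lie_derivative X w Y = \sum_(b : bool) \sum_(c : bool)
    (-1) ^+ (b && ~~ c) * lie_term b c (vpart b X) (vpart c Y).
Proof.
move=> VX /(form_eq1 VX)[wX0 wX1] VY; rewrite /lie_derivative.
have sY c := Vect_sder c VY.
have Y0 c b : vpart c Y (w (vpart b X)) = 0.
  by case: b; rewrite ?wX0 ?wX1; [exact: sder1 (sY c)|exact: additive_map0 (sder_additive (sY c))].
apply: eq_bigr => b _; rewrite (d1_sder (Vect_sder b VX) VY) //.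
rewrite /d0; have -> : Y (w (vpart b X)) = 0.
  by rewrite -(vpart_sum _ (Vect_additive VY)) !Y0 addr0.
by rewrite mulr0 addr0.
Qed.

End Forms.
End SuperAlgebra.

(** * Values at a point of the Lie derivative *)

Section PointDerivation.
Variables (R : realType) (A : superAlgType R).
Implicit Types (X Y Z : A -> A) (f g h : A) (b c : bool).

(** The algebraic properties of the evaluation of super-functions at a point of the basis. *)
Definition character (e : A -> R) : Prop :=
  [/\ e 1 = 1, forall f g, e (f + g) = e f + e g, forall f g, e (f * g) = e f * e g &
      forall f, homog true f -> e f = 0].

Section OneCharacter.
Variable e : A -> R.
Hypothesis He : character e.

Lemma character1 : e 1 = 1. Proof. by case: He. Qed.
Lemma characterD f g : e (f + g) = e f + e g. Proof. by case: He. Qed.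
Lemma characterM f g : e (f * g) = e f * e g. Proof. by case: He. Qed.
Lemma character_odd f : homog true f -> e f = 0. Proof. by case: He => _ _ _; exact. Qed.

Lemma character0 : e 0 = 0.
Proof. by apply: (addrI (e 0)); rewrite -characterD !addr0. Qed.

Lemma characterN f : e (- f) = - e f.
Proof. by apply: (addrI (e f)); rewrite -characterD !subrr character0. Qed.

Lemma characterB f g : e (f - g) = e f - e g.
Proof. by rewrite characterD characterN. Qed.

Lemma character_sign b f : e ((-1) ^+ b * f) = (-1) ^+ b * e f.
Proof. by case: b; rewrite ?expr0 ?mul1r // !expr1 !mulN1r characterN. Qed.

Lemma character_sum n (f : 'I_n -> A) : e (\sum_k f k) = \sum_k e (f k).
Proof. by apply: (big_morph e characterD character0). Qed.

(* The signs disappear because odd elements have value zero. *)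
Lemma character_derivation X f g : Vect X ->
  e (X (f * g)) = e (X f) * e g + e f * e (X g).
Proof.
move=> VX; have aX := Vect_additive VX.
have dX b c u v : homog c u ->
    e (vpart b X (u * v)) = e (vpart b X u) * e v + e u * e (vpart b X v).
  move=> cu; have [_ _ D] := Vect_sder b VX.
  rewrite (D c) // characterD character_sign !characterM; congr (_ + _).
  by case: c cu => cu; rewrite ?andbF ?expr0 ?mul1r // (character_odd cu) mul0r mulr0.
have {}dX b u v : e (vpart b X (u * v)) = e (vpart b X u) * e v + e u * e (vpart b X v).
  move: (vpart b X) (vpart_additive b aX) (dX b) => V aV dV.
  rewrite -(hpart_sum u) mulrDl !aV !characterD.
  by rewrite (dV false) ?(dV true); [ring|exact: homog_hpart..].
have E u : e (X u) = e (vpart false X u) + e (vpart true X u).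
  by rewrite -characterD vpart_sum.
by rewrite !E !dX; ring.
Qed.

Variables (w : (A -> A) -> A) (n : nat) (f g : 'I_n -> A).
Hypotheses (lw : form_linear w) (ew : form_even w).

(* The form [w] is [\sum_k d g_k . f_k] near the point of which [e] is the
   evaluation; the second clause is what remains of "near". *)
Definition local_expression := forall Y, Vect Y ->
  e (w Y) = e (\sum_k Y (g k) * f k) /\
  forall X, Vect X -> e (X (w Y)) = e (X (\sum_k Y (g k) * f k)).

Hypothesis loc : local_expression.

Lemma additive_map_sum X (u : 'I_n -> A) : additive_map X -> X (\sum_k u k) = \sum_k X (u k).
Proof. by move=> aX; exact: (big_morph X aX (additive_map0 aX)). Qed.

(** The terms [X (Y (g k))] cancel between [X (w Y)] and the bracket, so that [Y] is only ever
    applied last, just before [e]. *)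
Lemma lie_term_value b c X Y : sder b X -> sder c Y ->
  e (lie_term w b c X Y) =
  \sum_k (e (Y (g k)) * e (X (f k)) + (-1) ^+ (b && c) * e (Y (X (g k))) * e (f k)).
Proof.
move=> sX sY; have [VX VY] := (sder_Vect sX, sder_Vect sY).
rewrite /lie_term characterB (loc VY).2 // (loc (sder_Vect (sder_scomm sX sY))).1.
rewrite (additive_map_sum _ (sder_additive sX)) !character_sum -sumrB.
apply: eq_bigr => k _; rewrite character_derivation // characterM /scomm.
by rewrite characterB character_sign; ring.
Qed.

Lemma lie_term_value_ext b c X Y Y' : sder b X -> sder c Y -> sder c Y' ->
  (forall h, e (Y h) = e (Y' h)) ->
  e (lie_term w b c X Y) = e (lie_term w b c X Y').
Proof.
move=> sX sY sY' YY'; rewrite (lie_term_value sX sY) (lie_term_value sX sY').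
by apply: eq_bigr => k _; rewrite !YY'.
Qed.

(** Of the four pairs of components, those of equal parity give odd elements, which [e] kills. The
    even part of [X] with the odd part of [Y] gives 0 because that part of [Y] vanishes after
    [e]. *)
Lemma lie_derivative_value X Y : Vect X -> w X = 1 -> Vect Y ->
  (forall h, e (vpart true Y h) = 0) ->
  e (lie_derivative X w Y) = - e (lie_term w true false (vpart true X) (vpart false Y)).
Proof.
move=> VX wX VY Y1; rewrite lie_derivativeE // !big_bool /=.
have [sX0 sX1] := (Vect_sder false VX, Vect_sder true VX).
have [sY0 sY1] := (Vect_sder false VY, Vect_sder true VY).
have e11 := character_odd (lie_term_homog ew sX1 sY1).
have e00 := character_odd (lie_term_homog ew sX0 sY0).
have e01 : e (lie_term w false true (vpart false X) (vpart true Y)) = 0.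
  rewrite (@lie_term_value_ext _ _ _ _ _ sX0 sY1 (sder_0 _ _)); last by move=> h; rewrite Y1 character0.
  have X00 := additive_map0 (sder_additive sX0).
  rewrite /lie_term form0 // X00 (_ : scomm _ _ _ _ = fun=> 0) ?form0 ?subr0 ?character0 //.
  by apply/funext => h; rewrite /scomm X00 mulr0 subr0.
move: e11 e00 e01; move: (lie_term w) => T e11 e00 e01.
rewrite expr0 expr1 !mul1r mulN1r !characterD e11 e00 e01.
by rewrite characterN !(add0r, addr0).
Qed.

End OneCharacter.
End PointDerivation.

(** * Frobenius integrability of the kernel, and change of form and field *)

Section Kernel.
Variables (R : realType) (A : superAlgType R).
Implicit Types (X Y Z : A -> A) (f g h : A) (b c : bool) (e : A -> R).

Definition supercommutative := forall b c f g,
  homog b f -> homog c g -> f * g = (-1) ^+ (b && c) * (g * f).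

Hypothesis scA : supercommutative.

Lemma sder_scale k b g X : homog k g -> sder b X -> sder (k (+) b) (fun f => g * X f).
Proof.
move=> kg [lX pX dX]; split=> [r f h|c f cf|c f h cf].
- by rewrite lX mulrDr !mulrA (scalC r g).
- by rewrite -addbA; apply: homogM => //; exact: pX.
- rewrite (dX _ _ _ cf) mulrDr mulrA; congr (_ + _).
  have -> : f * (g * X h) = (-1) ^+ (c && k) * (g * f * X h).
    by rewrite mulrA (scA cf kg) !mulrA.
  clear; case: b; case: c; case: k; rewrite /= ?expr0 ?expr1 ?mul1r ?mulN1r ?mulrN ?opprK ?mulrA //.
Qed.

Variables (w : (A -> A) -> A) (F : set (A -> A)).
Hypotheses (lw : form_linear w) (ew : form_even w).
Hypotheses (lF : lie_subsuperalgebra F) (FE : F = [set Y | Vect Y /\ w Y = 0]).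

Lemma kernel_scomm b c X Y : sder b X -> sder c Y -> w X = 0 -> w Y = 0 ->
  w (scomm b c X Y) = 0.
Proof.
move=> sX sY wX wY; case: lF => _ _ _ _ brF.
have FK Z d : sder d Z -> w Z = 0 -> F Z by move=> sZ wZ; rewrite FE; split=> //; exact: sder_Vect sZ.
by have := brF X Y (FK _ _ sX wX) (FK _ _ sY wY); rewrite FE (bracketE sX sY) => -[].
Qed.

Section Transversal.
Variable X : A -> A.
Hypotheses (sX : sder true X) (wX : w X = 1).

(** The projection onto the kernel of [w] along [X]. It preserves parity, since [X] is odd and [w Y]
    has the parity opposite to that of [Y]. *)
Definition tangent_part Y : A -> A := fun f => Y f - w Y * X f.

Lemma sder_opp b Y : sder b Y -> sder b (fun f => - Y f).
Proof.
case=> lY pY dY; split=> [k f h|c f cf|c f h cf].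
- by rewrite lY mulrN; zmod.
- exact/homogN/pY.
- by rewrite (dY _ _ _ cf) opprD mulNr !mulrN.
Qed.

Lemma sder_form_scale b Y : sder b Y -> sder b (fun f => w Y * X f).
Proof.
move=> sY; have := sder_scale (form_homog ew sY) sX.
by apply: sder_eq; case: (b).
Qed.

Lemma sder_tangent_part b Y : sder b Y -> sder b (tangent_part Y).
Proof. by move=> sY; apply: sder_add => //; apply/sder_opp/sder_form_scale. Qed.

(** The second form [v] serves to compare two forms with the same kernel. *)
Lemma form_tangent_partE v b Y : form_linear v -> sder b Y ->
  v (tangent_part Y) = v Y - w Y * v X.
Proof.
move=> lv sY; have VX := sder_Vect sX; have VY := sder_Vect sY.
have E : (fun f => - w Y * X f) = (fun f => - (w Y * X f)).
  by apply/funext => f; rewrite mulNr.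
have VE : Vect (fun f => - w Y * X f).
  by rewrite E; exact: sder_Vect (sder_opp (sder_form_scale sY)).
rewrite (_ : tangent_part Y = fun f => Y f + - w Y * X f).
  by rewrite (lv.1 _ _ VY VE) (lv.2 _ _ VX) mulNr.
by apply/funext => f; rewrite mulNr.
Qed.

Lemma form_tangent_part b Y : sder b Y -> w (tangent_part Y) = 0.
Proof. by move=> sY; rewrite (form_tangent_partE lw sY) wX mulr1 subrr. Qed.

(* The contraction of an even field with [w] is odd, so it has value zero. *)
Lemma tangent_part_value e Y h : character e -> sder false Y ->
  e (tangent_part Y h) = e (Y h).
Proof.
move=> He sY; rewrite /tangent_part characterB // characterM //.
by rewrite (character_odd He (form_homog ew sY)) mul0r subr0.
Qed.

Lemma lie_term_kernel b c Y Z : sder b Y -> w Z = 0 ->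
  lie_term w b c Y Z = - w (scomm b c Y Z).
Proof. by move=> sY wZ; rewrite /lie_term wZ (additive_map0 (sder_additive sY)) sub0r. Qed.

Local Notation mu Z := (w (scomm true false X Z)).

(** The tangent part of [[X, Z1]] lies in the kernel, and so does its bracket with [Z2] by
    integrability. Only the bracket of [mu Z1 * X] with [Z2] contributes. *)
Lemma tangent_scomm Z1 Z2 : sder false Z1 -> sder false Z2 -> w Z1 = 0 -> w Z2 = 0 ->
  w (scomm true false (scomm true false X Z1) Z2) = mu Z1 * mu Z2 - Z2 (mu Z1).
Proof.
move=> s1 s2 w1 w2; have sXZ := sder_scomm sX s1; rewrite /= in sXZ.
have V0 := kernel_scomm (sder_tangent_part sXZ) s2 (form_tangent_part sXZ) w2.
have hmu : homog false (mu Z1) by apply: (form_homog ew sXZ).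
have sXZ2 : sder true (scomm true false X Z2) := sder_scomm sX s2.
(* [P] and [Q] are the two terms of the Leibniz expansion of the bracket of [mu Z1 * X] with
   [Z2]. *)
pose P f := mu Z1 * scomm true false X Z2 f.
pose Q f := - Z2 (mu Z1) * X f.
have hZmu : homog false (- Z2 (mu Z1)).
  by apply: homogN; case: s2 => _ pZ _; exact: (pZ false).
have sP : sder true P by exact: (sder_scale hmu sXZ2).
have sQ : sder true Q by exact: (sder_scale hZmu sX).
have sV : sder true (scomm true false (tangent_part (scomm true false X Z1)) Z2).
  exact: (sder_scomm (sder_tangent_part sXZ) s2).
have -> : scomm true false (scomm true false X Z1) Z2 =
    fun f => scomm true false (tangent_part (scomm true false X Z1)) Z2 f + (P f + Q f).
  apply/funext => f.
  have aZ2 := sder_additive s2; have [_ _ dZ2] := s2.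
  rewrite /P /Q /tangent_part; move: (w (scomm true false X Z1)) hmu => m hm.
  rewrite !scomm_even !(additive_mapB _ _ aZ2) (dZ2 false) //= expr0 mul1r mulrBr mulNr.
  zmod.
rewrite (lw.1 _ _ (sder_Vect sV) (sder_Vect (sder_add sP sQ))) V0 add0r.
rewrite (lw.1 _ _ (sder_Vect sP) (sder_Vect sQ)) (lw.2 _ _ (sder_Vect sXZ2)).
by rewrite (lw.2 _ _ (sder_Vect sX)) wX mulr1.
Qed.

(* Frobenius integrability makes [Z |-> w [X, Z]] a closed form along the kernel of [w]. *)
Lemma lie_term_kernel_closed e Z1 Z2 : character e ->
  sder false Z1 -> sder false Z2 -> w Z1 = 0 -> w Z2 = 0 ->
  e (lie_term w true false X (scomm false false Z1 Z2)) =
  e (Z1 (lie_term w true false X Z2)) - e (Z2 (lie_term w true false X Z1)).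
Proof.
move=> He s1 s2 w1 w2.
have w12 := kernel_scomm s1 s2 w1 w2; have s12 : sder false _ := sder_scomm s1 s2.
rewrite !(lie_term_kernel _ sX) // (additive_mapN _ (sder_additive s1)) (additive_mapN _ (sder_additive s2)).
have sX1 : sder true (scomm true false X Z1) := sder_scomm sX s1.
have sX2 : sder true (scomm true false X Z2) := sder_scomm sX s2.
have t12 : sder true (scomm true false (scomm true false X Z1) Z2) := sder_scomm sX1 s2.
have t21 : sder true (scomm true false (scomm true false X Z2) Z1) := sder_scomm sX2 s1.
(* The Jacobi identity, without signs because [Z1] and [Z2] are even. The products of [mu Z1] and
   [mu Z2] cancel once [e] is applied. *)
have E : scomm true false (scomm true false X Z1) Z2 =
    fun f => scomm true false X (scomm false false Z1 Z2) f +
             scomm true false (scomm true false X Z2) Z1 f.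
  apply/funext => f; rewrite !scomm_even (additive_mapB _ _ (sder_additive sX)).
  rewrite (additive_mapB _ _ (sder_additive s1)) (additive_mapB _ _ (sder_additive s2)); zmod.
have sX12 : sder true (scomm true false X (scomm false false Z1 Z2)) := sder_scomm sX s12.
have := congr1 w E; rewrite lw.1; [|exact: sder_Vect sX12|exact: sder_Vect t21].
rewrite (tangent_scomm s1 s2 w1 w2) (tangent_scomm s2 s1 w2 w1).
move/(congr1 e); rewrite !(characterB He, characterN He, characterD He, characterM He).
by lra.
Qed.

End Transversal.

(** For homogeneous [Z], the field [Z - w Z * X] is in the kernel of [w], which is also that of
    [v]. *)
Lemma kernel_eq_factor v X Y : form_linear v -> F = [set Z | Vect Z /\ v Z = 0] ->
  sder true X -> w X = 1 -> Vect Y -> v Y = w Y * v X.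
Proof.
move=> lv Fv sX wX VY.
have vT b Z : sder b Z -> v Z = w Z * v X.
  move=> sZ; apply/eqP; rewrite -subr_eq0 -(form_tangent_partE sX lv sZ); apply/eqP.
  suff : F (tangent_part X Z) by rewrite Fv => -[].
  rewrite FE; split; [exact: sder_Vect (sder_tangent_part sX sZ)|exact: form_tangent_part wX _ _ sZ].
rewrite (form_vpart lv VY) (form_vpart lw VY) mulrDl.
by congr (_ + _); apply: vT; exact: Vect_sder.
Qed.

(** With [v = w X'] and [W = X' - v X] in the kernel, [[X', Y] = [W, Y] + v [X, Y] - Y(v) X]. Since
    [e v * e u = 1], the extra term is the logarithmic derivative of [v] along [Y]. *)
Lemma lie_term_change e n (f g : 'I_n -> A) w' u X X' Y :
  character e -> local_expression e w f g ->
  form_linear w' -> (forall Z, Vect Z -> w' Z = w Z * u) ->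
  sder true X -> w X = 1 -> sder true X' -> w' X' = 1 -> sder false Y ->
  e (lie_term w' true false X' Y) =
  e (lie_term w true false X Y) + e (Y (w X')) * e u.
Proof.
move=> He loc lw' w'E sX wX sX' wX' sY.
have VX' := sder_Vect sX'; have VY := sder_Vect sY.
have sW := sder_tangent_part sX sX'; have wW := form_tangent_part sX wX sX'.
have sT := sder_tangent_part sX sY; have wT := form_tangent_part sX wX sY.
have uv : e (w X') * e u = 1 by rewrite -characterM // -w'E // wX' character1.
have hv : homog false (w X') := form_homog ew sX'.
have X'E h : X' h = tangent_part X X' h + w X' * X h by rewrite /tangent_part; zmod.
have sXY : sder true (scomm true false X Y) := sder_scomm sX sY.
have sWY : sder true (scomm true false (tangent_part X X') Y) := sder_scomm sW sY.
have sP : sder true (fun h => w X' * scomm true false X Y h) := sder_scale hv sXY.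
have hYv : homog false (- Y (w X')).
  by apply: homogN; case: sY => _ pY _; exact: (pY false).
have sQ : sder true (fun h => - Y (w X') * X h) := sder_scale hYv sX.
have wX'Y : w (scomm true false X' Y) =
    w (scomm true false (tangent_part X X') Y) + (w X' * w (scomm true false X Y) - Y (w X')).
  rewrite (_ : scomm true false X' Y = fun h => scomm true false (tangent_part X X') Y h +
     (w X' * scomm true false X Y h + - Y (w X') * X h)).
    rewrite (lw.1 _ _ (sder_Vect sWY) (sder_Vect (sder_add sP sQ))).
    rewrite (lw.1 _ _ (sder_Vect sP) (sder_Vect sQ)) (lw.2 _ _ (sder_Vect sXY)).
    by rewrite (lw.2 _ _ (sder_Vect sX)) wX mulr1.
  apply/funext => h; have aY := sder_additive sY; have [_ _ dY] := sY.
  rewrite !scomm_even (X'E h) (X'E (Y h)) aY (dY false) //= expr0 mul1r mulrBr mulNr; zmod.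
(* At [e] the field [Y] may be replaced by its tangent part, and the bracket of two fields of the
   kernel stays in the kernel. *)
have W0 : e (lie_term w true false (tangent_part X X') Y) = 0.
  rewrite (lie_term_value_ext He loc sW sY sT) => [|h]; last by rewrite tangent_part_value.
  by rewrite (lie_term_kernel _ sW wT) (kernel_scomm sW sT wW wT) oppr0 character0.
have e0 : e (w Y) = 0 := character_odd He (form_homog ew sY).
move: W0; rewrite /lie_term (w'E Y VY) (w'E _ (sder_Vect (sder_scomm sX' sY))) wX'Y.
rewrite !(characterB He) (character_derivation He) // (X'E (w Y)).
rewrite !(characterB He, characterD He, characterM He) e0 mul0r addr0 => W0.
(* What remains is an identity between real numbers: [a'] is eliminated with [W0], then [v' * u'] is
   replaced by 1. *)
have key (v' u' a a' b c d : R) : v' * u' = 1 -> a' - v' * a + v' * a - v' * a - c = 0 ->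
    (a' - v' * a + v' * a) * u' - (c + (v' * b - d)) * u' = a - b + d * u'.
  move=> vu ac; have -> : a' = c + v' * a by lra.
  transitivity ((v' * u') * (a - b) + d * u'); first by ring.
  by rewrite vu mul1r.
exact: key uv W0.
Qed.

(* [U] stands for the evaluations at the points near the one of [e]. *)
Variables (U : set (A -> R)) (e : A -> R).
Hypotheses (Ue : U e) (charU : forall e', U e' -> character e').
Hypothesis locU : forall e', U e' -> exists n (f g : 'I_n -> A), local_expression e' w f g.

(** Passing to tangent parts alters the Lie terms only by elements vanishing on all of [U]. The
    hypothesis on [N] says that [Y1] and [Y2] kill these at [e], so the closedness along the kernel
    can be used. *)
Lemma lie_term_closed X Y1 Y2 : sder true X -> w X = 1 -> sder false Y1 -> sder false Y2 ->
  (forall N, (forall e', U e' -> e' N = 0) -> e (Y1 N) = 0 /\ e (Y2 N) = 0) ->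
  (forall h, e (Y1 (Y2 h)) = e (Y2 (Y1 h))) ->
  e (Y1 (lie_term w true false X Y2)) = e (Y2 (lie_term w true false X Y1)).
Proof.
move=> sX wX s1 s2 nil comm; have He := charU Ue.
have [z1 z2] := (sder_tangent_part sX s1, sder_tangent_part sX s2).
have [wz1 wz2] := (form_tangent_part sX wX s1, form_tangent_part sX wX s2).
have nilt Y e' : sder false Y -> U e' ->
    e' (lie_term w true false X Y - lie_term w true false X (tangent_part X Y)) = 0.
  move=> sY Ue'; have He' := charU Ue'; have [n [f [g loc]]] := locU Ue'.
  rewrite characterB // (lie_term_value_ext He' loc sX sY (sder_tangent_part sX sY)) ?subrr //.
  by move=> h; rewrite tangent_part_value.
have nilw Y h e' : sder false Y -> U e' -> e' (w Y * X h) = 0.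
  move=> sY Ue'; have He' := charU Ue'.
  by rewrite characterM // (character_odd He' (form_homog ew sY)) mul0r.
have E12 : e (Y1 (lie_term w true false X Y2)) =
    e (tangent_part X Y1 (lie_term w true false X (tangent_part X Y2))).
  rewrite tangent_part_value //; apply/eqP; rewrite -subr_eq0 -characterB //.
  rewrite -(additive_mapB _ _ (sder_additive s1)); apply/eqP.
  by have [] := nil _ (fun e' => nilt Y2 e' s2).
have E21 : e (Y2 (lie_term w true false X Y1)) =
    e (tangent_part X Y2 (lie_term w true false X (tangent_part X Y1))).
  rewrite tangent_part_value //; apply/eqP; rewrite -subr_eq0 -characterB //.
  rewrite -(additive_mapB _ _ (sder_additive s2)); apply/eqP.
  by have [] := nil _ (fun e' => nilt Y1 e' s1).
rewrite E12 E21; apply/eqP; rewrite -subr_eq0 -(lie_term_kernel_closed sX wX) //; apply/eqP.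
have [n [f [g loc]]] := locU Ue.
have s12 : sder false (scomm false false (tangent_part X Y1) (tangent_part X Y2)) := sder_scomm z1 z2.
(* The commutator of the tangent parts has value zero at [e], like that of [Y1] and [Y2], so it may
   be replaced by the zero field. *)
rewrite (lie_term_value_ext He loc sX s12 (sder_0 A false)).
  rewrite (lie_term_kernel _ sX (form0 lw)) characterN // (_ : scomm _ _ _ _ = fun=> 0).
    by rewrite form0 // character0 // oppr0.
  by apply/funext => h; rewrite scomm_even (additive_map0 (sder_additive sX)) subrr.
move=> h; rewrite scomm_even characterB // !tangent_part_value // character0 //.
rewrite /tangent_part (additive_mapB _ _ (sder_additive s1)) (additive_mapB _ _ (sder_additive s2)).
have [_ N1] := nil _ (fun e' => nilw Y1 h e' s1).
have [N2 _] := nil _ (fun e' => nilw Y2 h e' s2).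
by rewrite !characterB // N1 N2 !subr0 comm subrr.
Qed.

End Kernel.

(** * Super-functions and local vector fields *)

Section GrassmannSign.
Variables (R : realType) (p q : nat).
Implicit Types (F G : {set 'I_q} -> 'rV[R]_p -> R) (I J K : {set 'I_q}).

(** As [I] and [J] are disjoint, each pair in [I * J] is an inversion for exactly one of the two
    orders. *)
Lemma grassmann_invC I J : (I :&: J)%SET = finset.set0 ->
  (grassmann_inv I J + grassmann_inv J I = #|I| * #|J|)%N.
Proof.
move=> IJ.
have invE I' J' : grassmann_inv I' J' =
    (\sum_i \sum_j ((i \in I') && (j \in J') && (j < i)%N : nat))%N.
  rewrite /grassmann_inv -sum1_card big_mkcond pair_bigA /=.
  by apply: eq_bigr => -[i j] _; rewrite -topredE /= andbA; case: ifP.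
have cardE I' : #|I'| = (\sum_i (i \in I' : nat))%N.
  by rewrite -sum1_card big_mkcond; apply: eq_bigr => i _; case: ifP.
rewrite (invE I J) (invE J I) [X in (_ + X)%N]exchange_big -big_split /= (cardE I) (cardE J).
rewrite big_distrl; apply: eq_bigr => i _; rewrite big_distrr -big_split.
apply: eq_bigr => j _ /=; case iI: (i \in I); case jJ: (j \in J) => //=.
case: (ltngtP j i) => // /val_inj ij; rewrite ij in jJ.
by have := finset.in_set0 i; rewrite -IJ finset.inE iI jJ.
Qed.

Lemma gmul_set0 F G y : gmul F G finset.set0 y = F finset.set0 y * G finset.set0 y.
Proof.
rewrite /gmul (big_pred1 finset.set0) => [|I]; last by rewrite finset.subset0.
rewrite finset.setD0 (_ : grassmann_inv _ _ = 0%N) ?expr0 ?mul1r //.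
by apply: eq_card0 => -[i j]; rewrite !inE.
Qed.

Lemma gmul_scalar (k : R) F K y :
  gmul (fun I _ => if I == finset.set0 then k else 0) F K y = k * F K y.
Proof.
rewrite /gmul (bigD1 finset.set0) ?finset.sub0set //= eqxx big1 => [|I /andP[_ /negbTE->]].
  rewrite finset.setD0 addr0 (_ : grassmann_inv _ _ = 0%N) ?expr0 ?mul1r //.
  by apply: eq_card0 => -[i j]; rewrite !inE.
by rewrite mulr0 mul0r.
Qed.

Lemma gmul_ext F F' G G' K y :
  (forall I, F I y = F' I y) -> (forall I, G I y = G' I y) ->
  gmul F G K y = gmul F' G' K y.
Proof. by move=> FF' GG'; apply: eq_bigr => I _; rewrite FF' GG'. Qed.

Lemma gmulC b c F G K y :
  (forall I, odd #|I| != b -> F I y = 0) -> (forall I, odd #|I| != c -> G I y = 0) ->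
  gmul F G K y = (-1) ^+ (b && c) * gmul G F K y.
Proof.
move=> F0 G0; rewrite /gmul (reindex_onto (fun I => K :\: I)%SET (fun I => K :\: I)%SET) /=; last first.
  by move=> I IK; rewrite finset.setDDr finset.setDv finset.set0U (finset.setIidPr IK).
rewrite big_distrr /=; apply: eq_big => [I|I].
  rewrite finset.subsetDl finset.setDDr finset.setDv finset.set0U /=.
  by apply/eqP/finset.setIidPr.
rewrite finset.subsetDl /= => /eqP KI; rewrite KI.
have [oI|/G0->] := eqVneq (odd #|I|) c; last by rewrite !(mulr0, mul0r).
have [oK|/F0->] := eqVneq (odd #|(K :\: I)%SET|) b; last by rewrite !(mulr0, mul0r).
have dIK : ((K :\: I) :&: I)%SET = finset.set0.
  by rewrite finset.setIDAC finset.setDIl finset.setDv finset.setI0.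
have := grassmann_invC dIK => /(congr1 odd); rewrite oddD oddM oK oI => E.
rewrite -[in LHS]signr_odd -[in RHS](signr_odd _ (grassmann_inv _ _)).
have -> : odd (grassmann_inv (K :\: I)%SET I) = (b && c) (+) odd (grassmann_inv I (K :\: I)%SET).
  by rewrite -E -addbA addbb addbF.
by rewrite signr_addb; ring.
Qed.

End GrassmannSign.

(** * Coefficients in charts, cutoffs, locality and lifts of coordinate fields *)

Section Charts.
Variables (R : realType) (p q : nat) (M : superManifold R p q).
Local Notation O := (superfun M).
Local Notation "[ 'emptyset' ]" := finset.set0.
Implicit Types (I : {set 'I_q}) (c : chart p q M) (U V W : set M) (f g h : O) (x : M).

Lemma chart_image_open c W : open W -> W `<=` dom c -> open (cmap c @` W).
Proof.
move=> oW Wc; have -> : cmap c @` W = (cmap c @` dom c) `&` [set y | W (cinv c y)].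
  apply/seteqP; split=> [_ [x Wx <-]|_ [[x cx <-] /=]].
    by split=> /=; [exists x; [exact: Wc|]|rewrite cmapK //; exact: Wc].
  by rewrite cmapK // => Wx; exists x.
rewrite openE => y [cy Wy]; rewrite /interior.
apply: filterI; first by apply: open_nbhs_nbhs; split=> //; exact: img_open.
by apply: (cinv_continuous cy); exact: open_nbhs_nbhs (conj oW Wy).
Qed.

Lemma chart_preimage_open c W (N : set 'rV[R]_p) : open W -> W `<=` dom c -> open N ->
  open (W `&` [set x | N (cmap c x)]).
Proof.
move=> oW Wc oN; rewrite openE => x [Wx Nx]; rewrite /interior.
apply: filterI; first exact: open_nbhs_nbhs (conj oW Wx).
by apply: (cmap_continuous (Wc _ Wx)); exact: open_nbhs_nbhs (conj oN Nx).
Qed.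

Lemma chart_coef0 c W I y : open W -> W `<=` dom c -> (cmap c @` W) y ->
  coef c (0 : sec M W) I y = 0.
Proof.
move=> oW Wc Wy; apply: (addrI (coef c (0 : sec M W) I y)).
by rewrite -Defs.coefD // !addr0.
Qed.

Lemma res0 U V : open U -> open V -> V `<=` U -> res U V (0 : sec M U) = 0.
Proof.
move=> oU oV VU; apply: (addrI (res U V 0)).
by rewrite -(resD (space_sheaf M)) // !addr0.
Qed.

Definition localize c f : sec M (dom c) := res setT (dom c) f.

Lemma localizeD c f g : localize c (f + g) = localize c f + localize c g.
Proof. by rewrite /localize (resD (space_sheaf M)) //; [exact: openT|exact: dom_open]. Qed.

Lemma localizeM c f g : localize c (f * g) = localize c f * localize c g.
Proof. by rewrite /localize (resM (space_sheaf M)) //; [exact: openT|exact: dom_open]. Qed.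

Lemma localize_hpart c b f : localize c (hpart b f) = hpart b (localize c f).
Proof. by rewrite /localize (res_hpart (space_sheaf M)) //; [exact: openT|exact: dom_open]. Qed.

Lemma localize_scal c k : localize c (scal k : O) = scal k.
Proof. by rewrite /localize (res_scal (space_sheaf M)) //; [exact: openT|exact: dom_open]. Qed.

Definition gcoef c f := coef c (localize c f).

Lemma gcoefD c f g I y : img c y -> gcoef c (f + g) I y = gcoef c f I y + gcoef c g I y.
Proof. by move=> cy; rewrite /gcoef localizeD Defs.coefD //; exact: dom_open. Qed.

Lemma gcoef0 c I y : img c y -> gcoef c 0 I y = 0.
Proof. by move=> cy; apply: (addrI (gcoef c 0 I y)); rewrite -gcoefD // !addr0. Qed.

Lemma gcoefN c f I y : img c y -> gcoef c (- f) I y = - gcoef c f I y.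
Proof.
by move=> cy; apply: (addrI (gcoef c f I y)); rewrite -gcoefD // !subrr gcoef0.
Qed.

Lemma gcoefM c f g I y : img c y -> gcoef c (f * g) I y = gmul (gcoef c f) (gcoef c g) I y.
Proof. by move=> cy; rewrite /gcoef localizeM Defs.coefM //; exact: dom_open. Qed.

Lemma gcoef_hpart c b f I y : img c y ->
  gcoef c (hpart b f) I y = if odd #|I| == b then gcoef c f I y else 0.
Proof. by move=> cy; rewrite /gcoef localize_hpart coef_hpart //; exact: dom_open. Qed.

Lemma gcoef_scal c k I y : img c y ->
  gcoef c (scal k) I y = if I == [emptyset] then k else 0.
Proof. by move=> cy; rewrite /gcoef localize_scal coef_scal //; exact: dom_open. Qed.

Lemma gcoef_scalM c k f I y : img c y -> gcoef c (scal k * f) I y = k * gcoef c f I y.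
Proof.
move=> cy; rewrite gcoefM // -gmul_scalar.
by apply: gmul_ext => // J; rewrite gcoef_scal.
Qed.

Lemma gcoef_smooth c f I : smooth_on (img c) (gcoef c f I).
Proof. by apply: coef_smooth => //; exact: dom_open. Qed.

Lemma gcoef_homog c b f I y : img c y -> homog b f -> odd #|I| != b -> gcoef c f I y = 0.
Proof. by move=> cy <- /negbTE Ib; rewrite gcoef_hpart // Ib. Qed.

Lemma gcoef_ev c f x : dom c x -> gcoef c f [emptyset] (cmap c x) = ev f x.
Proof.
move=> cx; rewrite /gcoef coef_ev //; last exact: dom_open.
by rewrite (ev_res (space_sheaf M)) //; [exact: openT|exact: dom_open].
Qed.

Lemma gcoef_ev_img c f y : img c y -> gcoef c f [emptyset] y = ev f (cinv c y).
Proof. by case=> x cx <-; rewrite gcoef_ev // cmapK. Qed.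

Lemma superfun_eq_charts f g :
  (forall c I y, img c y -> gcoef c f I y = gcoef c g I y) -> f = g.
Proof.
move=> fg; apply: (sheaf_separated (space_sheaf M) (C := [set V | exists c : chart p q M, V = dom c])).
- by move=> V [c ->]; exact: dom_open.
- apply/seteqP; split=> // x _; have [c cx] := space_charts x.
  by exists (dom c) => //; exists c.
- move=> V [c ->]; apply: (coef_inj (c := c)) => //; first exact: dom_open.
  exact: fg.
Qed.

(** Supercommutativity is not part of the structure of super-algebra; it is read off from the
    Grassmann product in charts. *)
Lemma superfun_supercommutative : supercommutative O.
Proof.
move=> b d f g bf dg; apply: superfun_eq_charts => c I y cy.
have -> : gcoef c ((-1) ^+ (b && d) * (g * f)) I y = (-1) ^+ (b && d) * gcoef c (g * f) I y.
  by case: (b && d); rewrite ?expr0 ?mul1r // !expr1 !mulN1r gcoefN.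
by rewrite !gcoefM //; apply: gmulC => J; apply: gcoef_homog.
Qed.

Lemma ev_character x : character (fun f : O => ev f x).
Proof.
have [c cx] := space_charts x.
have cy : img c (cmap c x) by exists x.
split=> [|f g|f g|f of_]; rewrite -!(gcoef_ev _ cx).
- by rewrite -scal_one gcoef_scal // eqxx.
- exact: gcoefD.
- by rewrite gcoefM // gmul_set0.
- by apply: gcoef_homog of_ _; rewrite // finset.cards0.
Qed.

(** The product of a bump function with [G] on the chart is glued to zero off its support. The
    support is compact, hence closed because the basis is Hausdorff. *)
Lemma cutoff c W x : open W -> W `<=` dom c -> W x ->
  exists chi : 'rV[R]_p -> R, exists K N : set M,
  [/\ closed K, K `<=` W, [/\ open N, N x & N `<=` W],
    forall z, N z -> chi (cmap c z) = 1 &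
    forall G : {set 'I_q} -> 'rV[R]_p -> R, (forall I, smooth_on (img c) (G I)) ->
      exists s : O, (forall I y, img c y -> gcoef c s I y = chi y * G I y) /\
        res setT (~` K) s = 0].
Proof.
move=> oW Wc Wx.
have [chi [K0 [N0 [schi cK0 K0W [oN0 N0x] [chi1 chi0]]]]] :=
  bump_function (chart_image_open oW Wc) (imageP (cmap c) Wx).
pose K := cinv c @` K0.
have KW : K `<=` W by move=> _ [y /K0W[z Wz <-] <-]; rewrite cmapK //; exact: Wc.
have cK : closed K.
  apply: compact_closed; first exact: space_hausdorff.
  apply: continuous_compact => //; apply: continuous_in_subspaceT => y.
  rewrite inE => /K0W[z Wz <-]; apply: cinv_continuous; exists z => //; exact: Wc.
exists chi, K, (W `&` [set z | N0 (cmap c z)]); split=> //.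
- by split=> //; exact: chart_preimage_open.
- by move=> z [_ /chi1].
move=> G sG.
have oK : open (~` K) by exact: closed_openC.
have chiK z : dom c z -> ~ K z -> chi (cmap c z) = 0.
  by move=> cz Kz; apply: chi0 => K0z; apply: Kz; exists (cmap c z) => //; rewrite cmapK.
(* Gluing takes a family indexed by all sets, so a section is chosen over every [V]; it is 0 unless
   [V] is an open subset of the chart domain. *)
have exV V : exists s : sec M V, open V ->
    (V `<=` dom c -> forall I y, (cmap c @` V) y -> coef c s I y = chi y * G I y) /\
    (V `<=` ~` K -> s = 0).
  have [[oV Vc]|nV] := pselect (open V /\ V `<=` dom c); last first.
    by exists 0 => oV; split=> // Vc; case: nV.
  have [|s sE] := coef_onto (c := c) (F := fun I y => chi y * G I y) oV Vc.
    move=> I; apply: smooth_expr_on; first exact: chart_image_open.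
    apply: smooth_mul; apply: smooth_base; first exact: smooth_on_sub schi.
    by apply: smooth_on_sub (sG I); exact: image_subset.
  exists s => _; split=> // VK; apply: (coef_inj (c := c)) => // I _ [z Vz <-].
  have Vz' : (cmap c @` V) (cmap c z) by exists z.
  by rewrite chart_coef0 // sE // chiK ?mul0r //; [exact: Vc|exact: VK].
have [s sP] : exists s : forall V, sec M V, forall V, open V ->
    (V `<=` dom c -> forall I y, (cmap c @` V) y -> coef c (s V) I y = chi y * G I y) /\
    (V `<=` ~` K -> s V = 0).
  by exists (fun V => sval (cid (exV V))) => V; exact: svalP (cid (exV V)).
have cover : setT = \bigcup_(V in [set V | V = dom c \/ V = ~` K]) V.
  apply/seteqP; split=> // z _; have [Kz|Kz] := pselect (K z).
    by exists (dom c); [left|apply: Wc; exact: KW].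
  by exists (~` K) => //; right.
have openC V : [set V | V = dom c \/ V = ~` K] V -> open V.
  by case=> ->; [exact: dom_open|].
have glue1 V V' U : open V -> open V' -> open U -> U `<=` V -> U `<=` V' ->
    V `<=` dom c -> V' `<=` ~` K -> res V U (s V) = res V' U (s V').
  move=> oV oV' oU UV UV' Vc V'K; have [_ ->//] := sP _ oV'; rewrite res0 //.
  have Uc : U `<=` dom c by move=> z /UV /Vc.
  apply: (coef_inj (c := c)) => // I _ [z Uz <-].
  have Uz' : (cmap c @` U) (cmap c z) by exists z.
  have Vz' : (cmap c @` V) (cmap c z) by exists z => //; exact: UV.
  rewrite chart_coef0 // coef_res //.
  have [sVE _] := sP _ oV; rewrite sVE // chiK ?mul0r //; first exact: Uc.
  by apply: V'K; exact: UV'.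
have oc := dom_open c.
have glue V : V = dom c \/ V = ~` K -> forall V', V' = dom c \/ V' = ~` K ->
    res V (V `&` V') (s V) = res V' (V `&` V') (s V').
  have oI V1 V2 : open V1 -> open V2 -> open (V1 `&` V2) by exact: openI.
  by case=> -> V' [] ->; [by []| |apply: esym|by []];
    apply: glue1 => //; exact: oI.
have [f fP] := sheaf_glue (space_sheaf M) openC cover (fun V V' CV CV' => glue V CV V' CV').
exists f; split=> [I y cy|]; last by rewrite fP /=; [have [_ ->] := sP _ oK|right].
rewrite /gcoef /localize fP /=; last by left.
by have [+ _] := sP _ (dom_open c); apply.
Qed.

Lemma superfun_eq_cover c (K : set M) f g : closed K -> K `<=` dom c ->
  (forall I y, img c y -> gcoef c f I y = gcoef c g I y) ->
  res setT (~` K) f = res setT (~` K) g -> f = g.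
Proof.
move=> cK Kc fgc fgK.
apply: (sheaf_separated (space_sheaf M) (C := [set V | V = dom c \/ V = ~` K])).
- by move=> V [] ->; [exact: dom_open|exact: closed_openC].
- apply/seteqP; split=> // z _; have [Kz|Kz] := pselect (K z).
    by exists (dom c); [left|exact: Kc].
  by exists (~` K) => //; right.
- move=> V [] -> //; apply: (coef_inj (c := c)) => //; exact: dom_open.
Qed.

Lemma ev_res0 W x f : open W -> W x -> res setT W f = 0 -> ev f x = 0.
Proof.
move=> oW Wx f0; have [c cx] := space_charts x.
have oWc : open (W `&` dom c) by apply: openI => //; exact: dom_open.
have Wcc : W `&` dom c `<=` dom c by exact: subIsetr.
have WcW : W `&` dom c `<=` W by exact: subIsetl.
rewrite -(ev_res (space_sheaf M) f openT oWc) //.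
rewrite -(res_comp (space_sheaf M) f openT oW oWc) // f0 res0 //.
rewrite -(coef_ev (c := c)) // chart_coef0 //; by exists x.
Qed.

(** For a cutoff [s] supported in [W] with value 1 at [x], [s * f = 0]. The Leibniz rule at [x] then
    gives the claim, as [f] has value 0 there. *)
Lemma Vect_local (X : O -> O) W x f : Vect X -> open W -> W x -> res setT W f = 0 ->
  ev (X f) x = 0.
Proof.
move=> VX oW Wx f0; have [c cx] := space_charts x.
have oWc : open (W `&` dom c) by apply: openI => //; exact: dom_open.
have [|//|chi [K [N [cK KW [oN Nx NW] chi1 ext]]]] := @cutoff c _ x oWc.
  exact: subIsetr.
have [|s [sE sK]] := ext (fun I _ => if I == [emptyset] then 1 else 0).
  by move=> I; apply: smooth_expr_on; [exact: img_open|exact: smooth_cst].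
have oK : open (~` K) by exact: closed_openC.
have sf0 : s * f = 0.
  apply: (sheaf_separated (space_sheaf M) (C := [set V | V = W \/ V = ~` K])).
  - by move=> V [] ->.
  - apply/seteqP; split=> // z _; have [Kz|Kz] := pselect (K z).
      by exists W; [left|have [] := KW z Kz].
    by exists (~` K) => //; right.
  - by move=> V [] ->; rewrite (resM (space_sheaf M)) ?res0 ?f0 ?sK ?mulr0 ?mul0r //; exact: openT.
have := character_derivation (ev_character x) s f VX.
rewrite sf0 (additive_map0 (Vect_additive VX)) (character0 (ev_character x)).
rewrite (ev_res0 oW Wx f0) mulr0 add0r -(gcoef_ev s cx) sE; last by exists x.
by rewrite eqxx chi1 // !mul1r.
Qed.

(** The defining equality near [x] survives the application of a vector field by locality. *)
Lemma one_form_local_expression (w : (O -> O) -> O) x : one_form w ->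
  exists W n (f g : 'I_n -> O), [/\ open W, W x &
    forall z, W z -> local_expression (fun h : O => ev h z) w f g].
Proof.
move=> [_ /(_ x) [W [n [f [g [oW Wx E]]]]]]; exists W, n, f, g; split=> // z Wz Y VY.
have E0 : res setT W (w Y - \sum_k Y (g k) * f k) = 0.
  rewrite (resD (space_sheaf M)) ?E //; last exact: openT.
  by rewrite -(resD (space_sheaf M)) ?subrr ?res0 //; exact: openT.
split.
  apply/eqP; rewrite -subr_eq0 -(characterB (ev_character z)); apply/eqP.
  exact: ev_res0 E0.
move=> X VX; apply/eqP; rewrite -subr_eq0 -(characterB (ev_character z)); apply/eqP.
by rewrite -(additive_mapB _ _ (Vect_additive VX)); exact: Vect_local E0.
Qed.

(** Only the tangent vector to the basis at [x] is prescribed; unlike the values of [Y] on all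
    coefficients, this is all that the Lie term sees. *)
Definition lifts c i x (Y : O -> O) := forall h,
  ev (Y h) x = partial i (fun y => ev h (cinv c y)) (cmap c x).

Lemma gcoef_partial_ev c i x h : dom c x ->
  partial i (gcoef c h [emptyset]) (cmap c x) = partial i (fun y => ev h (cinv c y)) (cmap c x).
Proof.
move=> cx; apply: (partial_eq (V := img c)); first exact: img_open.
  by exists x.
by move=> z cz; exact: gcoef_ev_img.
Qed.

Lemma is_ddx_near_lifts c i x Y : is_ddx_near c i x Y ->
  exists W, [/\ open W, W x, W `<=` dom c & forall z, W z -> lifts c i z Y].
Proof.
move=> [VY [W [oW Wx Wc E]]]; exists W; split=> // z Wz h.
rewrite -(gcoef_ev _ (Wc _ Wz)) -gcoef_partial_ev; last exact: Wc.
by rewrite /gcoef E //; exists z.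
Qed.

Lemma ev_even x h : ev (hpart false h) x = ev h x.
Proof.
rewrite -[in RHS](hpart_sum h) (characterD (ev_character x)).
by rewrite (character_odd (ev_character x) (homog_hpart true h)) addr0.
Qed.

Lemma lifts_nil c i x Y N W : dom c x -> lifts c i x Y -> open W -> W x ->
  (forall z, W z -> ev N z = 0) -> ev (Y N) x = 0.
Proof.
move=> cx YE oW Wx N0; rewrite YE.
have oWc : open (W `&` dom c) by apply: openI => //; exact: dom_open.
rewrite (partial_eq (V := cmap c @` (W `&` dom c)) (g := fun=> 0)).
- exact: derive_cst.
- by apply: chart_image_open => //; exact: subIsetr.
- by exists x.
- by move=> _ [z [Wz cz] <-]; rewrite cmapK // N0.
Qed.

(** On an even function the odd component gives an odd function. On an odd one it gives the
    derivative of a body that is identically zero. *)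
Lemma lifts_odd c i x Y h : dom c x -> lifts c i x Y -> ev (vpart true Y h) x = 0.
Proof.
move=> cx YE; rewrite /vpart (characterD (ev_character x)).
rewrite (character_odd (ev_character x) (homog_hpart true _)) add0r ev_even.
apply: lifts_nil cx YE (openT) _ _ => // z _.
exact: (character_odd (ev_character z) (homog_hpart true h)).
Qed.

Lemma lifts_even c i x Y : Vect Y -> dom c x -> lifts c i x Y -> lifts c i x (vpart false Y).
Proof.
move=> VY cx YE h; rewrite -YE -[in RHS](vpart_sum h (Vect_additive VY)).
by rewrite (characterD (ev_character x)) (lifts_odd h cx YE) addr0.
Qed.

Lemma gdx_scal_add c i k f g I y : img c y ->
  gdx i (gcoef c (scal k * f + g)) I y = k * gdx i (gcoef c f) I y + gdx i (gcoef c g) I y.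
Proof.
move=> cy; rewrite /gdx.
rewrite (partial_eq (V := img c) (g := fun y => k * gcoef c f I y + gcoef c g I y)) //.
- apply: partialE; apply: is_deriveD.
    by apply: is_deriveZ; apply: smooth_on_is_derive cy; exact: gcoef_smooth.
  by apply: smooth_on_is_derive cy; exact: gcoef_smooth.
- exact: img_open.
- by move=> z cz; rewrite gcoefD // gcoef_scalM.
Qed.

Lemma gdxM c i f g I y : img c y ->
  gdx i (gcoef c (f * g)) I y =
  gmul (gdx i (gcoef c f)) (gcoef c g) I y + gmul (gcoef c f) (gdx i (gcoef c g)) I y.
Proof.
move=> cy; rewrite /gdx.
rewrite (partial_eq (V := img c) (g := gmul (gcoef c f) (gcoef c g) I)) //; first last.
- by move=> z cz; rewrite gcoefM.
- exact: img_open.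
apply: partialE; rewrite /gmul -big_split; apply: is_derive_bigsum => J _ /=.
have [dF dG] := (smooth_on_is_derive i (@gcoef_smooth c f J) cy,
  smooth_on_is_derive i (@gcoef_smooth c g (I :\: J)%SET) cy).
set e := (-1) ^+ _; set F := gcoef c f J; set G := gcoef c g _.
apply: is_derive_eq; rewrite -[LHS]/(e * F y * partial i G y + G y * (e * partial i F y)); ring.
Qed.

Lemma gdx_smooth c i f I : smooth_on (img c) (gdx i (gcoef c f) I).
Proof. exact/smooth_on_partial/gcoef_smooth. Qed.

Lemma gmulZl (k : R) (F G : {set 'I_q} -> 'rV[R]_p -> R) I y :
  gmul (fun J z => k * F J z) G I y = k * gmul F G I y.
Proof. by rewrite /gmul big_distrr; apply: eq_bigr => J _ /=; ring. Qed.

Lemma gmulZr (k : R) (F G : {set 'I_q} -> 'rV[R]_p -> R) I y :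
  gmul F (fun J z => k * G J z) I y = k * gmul F G I y.
Proof. by rewrite /gmul big_distrr; apply: eq_bigr => J _ /=; ring. Qed.

(** The field is [chi] times the coordinate field, extended by zero. Its Leibniz rule is checked
    separately in the chart and off the support. *)
Lemma is_ddx_near_exists c i x : dom c x -> exists Y, is_ddx_near c i x Y.
Proof.
move=> cx; have [//|//|chi [K [N [cK Kc [oN Nx Nc] chi1 ext]]]] := @cutoff c _ x (dom_open c).
have oK : open (~` K) by exact: closed_openC.
have [Y YP] := choice (fun f : O => ext (gdx i (gcoef c f)) (fun I => gdx_smooth i f I)).
have YE f I y : img c y -> gcoef c (Y f) I y = chi y * gdx i (gcoef c f) I y.
  by move=> cy; have [+ _] := YP f; apply.
have YK f : res setT (~` K) (Y f) = 0 by have [] := YP f.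
have KT : ~` K `<=` [set: M] by [].
have sY : sder false Y.
  split=> [k f g|b f bf|b f g bf].
  - apply: (superfun_eq_cover cK Kc) => [I y cy|].
      by rewrite gcoefD // gcoef_scalM // !YE // gdx_scal_add //; ring.
    rewrite (resD (space_sheaf M) _ _ openT oK KT) (resM (space_sheaf M) _ _ openT oK KT).
    by rewrite !YK mulr0 addr0.
  - apply: (superfun_eq_cover cK Kc) => [I y cy|].
      rewrite gcoef_hpart // YE //; case: eqP => // Ib.
      rewrite (_ : gdx _ _ _ _ = 0) ?mulr0 //.
      rewrite /gdx (partial_eq (V := img c) (g := fun=> 0)) //; first exact: derive_cst.
        exact: img_open.
      by move=> z cz; apply: gcoef_homog cz bf _; apply/eqP.
    by rewrite (res_hpart (space_sheaf M) _ _ openT oK KT) YK hpart0.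
  - rewrite expr0 mul1r; apply: (superfun_eq_cover cK Kc) => [I y cy|].
      rewrite gcoefD // !gcoefM // YE // gdxM // mulrDr -gmulZl -gmulZr.
      by congr (_ + _); apply: gmul_ext => // J; rewrite YE.
    rewrite (resD (space_sheaf M) _ _ openT oK KT) !(resM (space_sheaf M) _ _ openT oK KT).
    by rewrite !YK mulr0 mul0r addr0.
exists Y; split; first exact: sder_Vect sY.
exists N; split=> // f I _ [z Nz <-].
have cz : img c (cmap c z) by exists z => //; exact: Nc.
by rewrite -/(localize c (Y f)) -/(gcoef c (Y f)) YE // chi1 // mul1r.
Qed.

Lemma xget_lifts c i x : dom c x ->
  Vect (xget (fun=> 0) (is_ddx_near c i x)) /\
  exists W, [/\ open W, W x, W `<=` dom c &
    forall z, W z -> lifts c i z (xget (fun=> 0) (is_ddx_near c i x))].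
Proof.
move=> cx; have /xgetPex H := is_ddx_near_exists i cx.
have {}H := H (fun=> 0); split; first by case: H.
exact: is_ddx_near_lifts H.
Qed.

(** A coordinate of [c'] is the body of a section on the overlap, whose coefficients in [c] are
    smooth; this makes changes of coordinates smooth. *)
Lemma coord_section c c' k : exists f : sec M (dom c `&` dom c'), forall x,
  dom c x -> dom c' x -> coef c f [emptyset] (cmap c x) = cmap c' x 0 k.
Proof.
have oW : open (dom c `&` dom c') by apply: openI; exact: dom_open.
have Wc : dom c `&` dom c' `<=` dom c by exact: subIsetl.
have Wc' : dom c `&` dom c' `<=` dom c' by exact: subIsetr.
have [|f fE] := coef_onto (c := c') (F := fun I y => if I == [emptyset] then y 0 k else 0) oW Wc'.
  move=> I; apply: smooth_expr_on; first exact: chart_image_open.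
  by case: (I == _); [exact: smooth_coord|exact: smooth_cst].
exists f => x cx c'x; have Wx : (dom c `&` dom c') x by [].
by rewrite coef_ev // -(coef_ev (c := c')) // fE ?eqxx //; exists x.
Qed.

Lemma superfun_chain c c' i x h : dom c x -> dom c' x ->
  partial i (fun y => ev h (cinv c y)) (cmap c x) =
  \sum_(k < p) partial i (fun y => cmap c' (cinv c y) 0 k) (cmap c x) *
    partial k (fun y => ev h (cinv c' y)) (cmap c' x).
Proof.
move=> cx c'x.
have oW : open (dom c `&` dom c') by apply: openI; exact: dom_open.
have Wc : dom c `&` dom c' `<=` dom c by exact: subIsetl.
have oV := chart_image_open oW Wc.
have Vx : (cmap c @` (dom c `&` dom c')) (cmap c x) by exists x.
pose V := cmap c @` (dom c `&` dom c').
(* The [i]-th coordinate line of [c] through [x], seen in the chart [c']. *)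
pose gam (t : R) := cmap c' (cinv c (t *: (delta_mx 0 i : 'rV[R]_p) + cmap c x)).
have gam0 : gam 0 = cmap c' x by rewrite /gam scale0r add0r cmapK.
have dcoord k : is_derive (cmap c x) (delta_mx 0 i : 'rV[R]_p)
    (fun y => cmap c' (cinv c y) 0 k) (partial i (fun y => cmap c' (cinv c y) 0 k) (cmap c x)).
  have [f fE] := coord_section c c' k.
  apply: (smooth_on_is_derive (V := V)) => //.
  apply: (smooth_on_eq (f := coef c f [emptyset])) => //; last exact: coef_smooth.
  by move=> _ [z [cz c'z] <-]; rewrite fE // cmapK.
apply: partialE; apply: (near_eq_is_derive (f := fun y => gcoef c' h [emptyset] (cmap c' (cinv c y)))).
  apply: filterS (open_nbhs_nbhs (conj oV Vx)) => _ [z [cz c'z] <-].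
  by rewrite !cmapK // gcoef_ev.
apply/is_derive_line.
have := @is_derive_along_curve R p (img c') (gcoef c' h [emptyset]) gam
  (fun k => partial i (fun y => cmap c' (cinv c y) 0 k) (cmap c x)).
have oc' : open (img c') by exact: img_open.
have c'y : img c' (cmap c' x) by exists x.
rewrite gam0 => /(_ oc' (@gcoef_smooth c' h [emptyset]) c'y) H.
rewrite (eq_bigr (fun k => partial i (fun y => cmap c' (cinv c y) 0 k) (cmap c x) *
   partial k (gcoef c' h [emptyset]) (cmap c' x))) => [|k _]; last by rewrite gcoef_partial_ev.
apply: H => k.
exact: (proj1 (is_derive_line (fun y => cmap c' (cinv c y) 0 k) (cmap c x)
  (delta_mx 0 i : 'rV[R]_p) _) (dcoord k)).
Qed.

End Charts.

(** * The projected Lie derivative *)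

Section Projection.
Variables (R : realType) (p q : nat) (M : superManifold R p q).
Local Notation O := (superfun M).
Implicit Types (c : chart p q M) (x : M) (h : O) (Y : O -> O).

Lemma ev_smooth c h : smooth_on (img c) (fun y => ev h (cinv c y)).
Proof.
apply: (smooth_on_eq (f := gcoef c h finset.set0)); first exact: img_open.
  by move=> y cy; rewrite gcoef_ev_img.
exact: gcoef_smooth.
Qed.

Variable a : (O -> O) -> O.
Hypotheses (a1 : one_form a) (ea : form_even a).
Let la : form_linear a := a1.1.

Section TransversalField.
Variable X : O -> O.
Hypotheses (VX : Vect X) (aX : a X = 1).
Local Notation X1 := (vpart true X).
Local Notation L := (lie_term a true false X1).

(** The even component of the field chosen in the projection and [Y] induce the same tangent vector
    at [x], so their Lie terms have the same value. *)
Lemma form_proj_lifts c i x Y : dom c x -> sder false Y -> lifts c i x Y ->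
  form_proj (lie_derivative X a) c i (cmap c x) = - ev (L Y) x.
Proof.
move=> cx sY YE; rewrite /form_proj cmapK //.
have [VZ [W [_ Wx _ /(_ x Wx)]]] := xget_lifts i cx.
move: (xget _ _) VZ => Z VZ ZE.
have [U [n [f [g [_ Ux /(_ x Ux) loc]]]]] := one_form_local_expression x a1.
rewrite (lie_derivative_value (ev_character x) la ea loc VX aX VZ) => [|h]; last first.
  exact: lifts_odd ZE.
congr (- _); apply: (lie_term_value_ext (ev_character x) loc (Vect_sder true VX) (Vect_sder false VZ) sY).
by move=> h; rewrite (lifts_even VZ cx ZE) YE.
Qed.

Lemma even_lift_exists c i x : dom c x -> exists Y, sder false Y /\
  exists W, [/\ open W, W x, W `<=` dom c & forall z, W z -> lifts c i z Y].
Proof.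
move=> cx; have [VZ [W [oW Wx Wc WZ]]] := xget_lifts i cx.
exists (vpart false (xget (fun=> 0) (is_ddx_near c i x))); split; first exact: Vect_sder.
by exists W; split=> // z Wz; apply: lifts_even => //; [exact: Wc|exact: WZ].
Qed.

(* Only values of super-functions occur on the right: this does not depend on
   the choice made by [xget], and is a combination of differentials of
   functions on the basis. *)
Lemma form_proj_expression x0 : exists W n (f g : 'I_n -> O), [/\ open W, W x0 &
  forall c i x, W x -> dom c x -> form_proj (lie_derivative X a) c i (cmap c x) =
    - \sum_k (partial i (fun y => ev (g k) (cinv c y)) (cmap c x) * ev (X1 (f k)) x +
              partial i (fun y => ev (X1 (g k)) (cinv c y)) (cmap c x) * ev (f k) x)].
Proof.
have [W [n [f [g [oW Wx0 loc]]]]] := one_form_local_expression x0 a1.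
exists W, n, f, g; split=> // c i x Wx cx.
have [Y [sY [U [_ Ux _ /(_ x Ux) YE]]]] := even_lift_exists i cx.
rewrite (form_proj_lifts cx sY YE).
rewrite (lie_term_value (ev_character x) (loc x Wx) (Vect_sder true VX) sY).
by congr (- _); apply: eq_bigr => k _; rewrite !YE expr0 mul1r.
Qed.

(** Both clauses come from the local expression: its ingredients are smooth, and the chain rule
    between charts applies to each differential in it. *)
Lemma form_proj_basis_one_form : basis_one_form (form_proj (lie_derivative X a)).
Proof.
split=> [c i|c c' x i cx c'x].
  apply: smooth_on_local => _ [x0 cx0 <-].
  have [W [n [f [g [oW Wx0 E]]]]] := form_proj_expression x0.
  have oWc : open (W `&` dom c) by apply: openI => //; exact: dom_open.
  have Wcc : W `&` dom c `<=` dom c by exact: subIsetr.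
  exists (cmap c @` (W `&` dom c)); first by exists x0.
  have oV := chart_image_open oWc Wcc.
  have Vc : cmap c @` (W `&` dom c) `<=` img c by exact: image_subset.
  apply: (smooth_on_eq (f := fun y => -1 *
    \sum_k (partial i (fun y => ev (g k) (cinv c y)) y * ev (X1 (f k)) (cinv c y) +
            partial i (fun y => ev (X1 (g k)) (cinv c y)) y * ev (f k) (cinv c y)))) => //.
    by move=> _ [x [Wx cx] <-]; rewrite E // cmapK // mulN1r.
  have sm h : smooth_expr (cmap c @` (W `&` dom c)) (fun y => ev h (cinv c y)).
    by apply/smooth_base/(smooth_on_sub Vc)/ev_smooth.
  have smp h : smooth_expr (cmap c @` (W `&` dom c)) (partial i (fun y => ev h (cinv c y))).
    by apply/smooth_base/(smooth_on_sub Vc)/smooth_on_partial/ev_smooth.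
  apply: smooth_expr_on => //; apply: smooth_mul; first exact: smooth_cst.
  by apply: smooth_expr_sum => k; apply: smooth_add; apply: smooth_mul.
have [W [n [f [g [_ Wx E]]]]] := form_proj_expression x.
rewrite E // (eq_bigr (fun k => - (partial i (fun y => cmap c' (cinv c y) 0 k) (cmap c x) *
   \sum_j (partial k (fun y => ev (g j) (cinv c' y)) (cmap c' x) * ev (X1 (f j)) x +
              partial k (fun y => ev (X1 (g j)) (cinv c' y)) (cmap c' x) * ev (f j) x)))) => [|k _].
  rewrite sumrN; congr (- _).
  under [RHS]eq_bigr => k _ do rewrite big_distrr /=.
  rewrite exchange_big; apply: eq_bigr => j _ /=.
  rewrite !(superfun_chain _ _ cx c'x) !big_distrl -big_split; apply: eq_bigr => k _ /=; ring.
by rewrite E // mulrN.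
Qed.

End TransversalField.
End Projection.

(** * Closedness and independence of the cohomology class *)

Section Class.
Variables (R : realType) (p q : nat) (M : superManifold R p q).
Local Notation O := (superfun M).
Variable a : (O -> O) -> O.
Hypotheses (a1 : one_form a) (ea : form_even a).
Let la : form_linear a := a1.1.
Variable F : set (O -> O).
Hypotheses (lF : lie_subsuperalgebra F) (FE : F = [set Y | Vect Y /\ a Y = 0]).

Lemma form_proj_closed X : Vect X -> a X = 1 ->
  basis_closed (form_proj (lie_derivative X a)).
Proof.
move=> VX aX c i j _ [x cx <-].
have sX := Vect_sder true VX; have [_ aX1] := form_eq1 la ea VX aX.
have [Yi [si [Wi [oWi Wix Wic Ei]]]] := even_lift_exists i cx.
have [Yj [sj [Wj [oWj Wjx Wjc Ej]]]] := even_lift_exists j cx.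
have [U [n [f [g [oU Ux loc]]]]] := one_form_local_expression x a1.
pose W := (Wi `&` Wj) `&` U.
have oW : open W by apply: openI => //; exact: openI.
have Wc : W `<=` dom c by move=> z [[/Wic]].
have Wx : W x by [].
have oV := chart_image_open oW Wc.
have Vx : (cmap c @` W) (cmap c x) by exists x.
pose L := lie_term a true false (vpart true X).
(* Since the coefficient is differentiated, [Yl] must be a lift on a whole neighborhood of [x]; for
   [Yk] the point [x] suffices. *)
have dproj k l Yk Yl : sder false Yl -> lifts c k x Yk -> (forall z, W z -> lifts c l z Yl) ->
    partial k (form_proj (lie_derivative X a) c l) (cmap c x) = - ev (Yk (L Yl)) x.
  move=> sl Ek El; rewrite Ek.
  rewrite (partial_eq (V := cmap c @` W) (g := fun y => - ev (L Yl) (cinv c y))) //.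
    apply: partialE; apply: is_deriveN.
    by apply: (smooth_on_is_derive (V := img c)); [exact: ev_smooth|exists x].
  by move=> _ [z Wz <-]; rewrite (form_proj_lifts a1 ea VX aX (Wc _ Wz) sl (El z Wz)) cmapK //; exact: Wc.
have EiW z : W z -> lifts c i z Yi by case=> -[/Ei].
have EjW z : W z -> lifts c j z Yj by case=> -[_ /Ej].
rewrite (dproj i j _ _ sj (EiW x Wx) EjW) (dproj j i _ _ si (EjW x Wx) EiW).
congr (- _).
have dd k l Yk Yl h : lifts c k x Yk -> (forall z, W z -> lifts c l z Yl) ->
    ev (Yk (Yl h)) x = partial k (partial l (fun y => ev h (cinv c y))) (cmap c x).
  move=> Ek El; rewrite Ek; apply: (partial_eq (V := cmap c @` W)) => //.
  by move=> _ [z Wz <-]; rewrite cmapK ?El //; exact: Wc.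
(* The abstract lemma is used with the evaluations at the points of [W]. The lifts commute at [x] by
   the symmetry of second derivatives. *)
apply: (@lie_term_closed _ _ (@superfun_supercommutative _ _ _ M) _ _ la ea lF FE
  [set e | exists2 z, W z & e = (fun h => ev h z)] (fun h => ev h x)) => //.
- by exists x.
- by move=> _ [z _ ->]; exact: ev_character.
- by move=> _ [z [_ Uz] ->]; exists n, f, g; exact: loc.
- move=> N N0; have {}N0 z : W z -> ev N z = 0.
    by move=> Wz; apply: (N0 (fun h => ev h z)); exists z.
  by split; [exact: (lifts_nil cx (EiW x Wx) oW Wx N0)|
    exact: (lifts_nil cx (EjW x Wx) oW Wx N0)].
move=> h /=; rewrite (dd i j _ _ h (EiW x Wx) EjW) (dd j i _ _ h (EjW x Wx) EiW).
apply: (partial_comm (V := img c)); [exact: img_open|by exists x|exact: ev_smooth].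
Qed.

(** The body of [v = a(X')], taken with the odd part of [X'], vanishes nowhere because it has
    inverse [u]. The logarithm of its absolute value is thus a smooth primitive on the whole basis,
    whatever the sign of [v]. *)
Lemma form_proj_cohomologous X a' X' : Vect X -> a X = 1 ->
  one_form a' -> form_even a' -> F = [set Y | Vect Y /\ a' Y = 0] ->
  Vect X' -> a' X' = 1 ->
  cohomologous (form_proj (lie_derivative X a)) (form_proj (lie_derivative X' a')).
Proof.
move=> VX aX a1' ea' FE' VX' aX'; have la' : form_linear a' := a1'.1.
have sX := Vect_sder true VX; have [_ aX1] := form_eq1 la ea VX aX.
have sX' := Vect_sder true VX'; have [_ aX1'] := form_eq1 la' ea' VX' aX'.
have scO := @superfun_supercommutative _ _ _ M.
have a'E Y : Vect Y -> a' Y = a Y * a' (vpart true X).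
  exact: (kernel_eq_factor scO la ea FE la' FE' sX aX1).
pose u := a' (vpart true X); pose v := a (vpart true X').
have uv x : ev v x * ev u x = 1.
  rewrite -(characterM (ev_character x)) -a'E ?aX1' ?(character1 (ev_character x)) //.
  exact: Vect_vpart.
have v0 x : ev v x != 0.
  by apply/eqP => v0; have := uv x; rewrite v0 mul0r => /esym/eqP; rewrite oner_eq0.
(* [r t] is the logarithm of the absolute value of [t]. *)
pose r (t : R) := 2^-1 * ln (t * t).
have tt_gt0 (t : R) : t != 0 -> 0 < t * t by move=> t0; rewrite -expr2 exprn_even_gt0.
have rE (t : R) : t != 0 -> is_derive t 1 r t^-1.
  move=> t0; have dsq : is_derive t 1 (fun s : R => s * s) (t *: 1 + t *: 1).
    exact: (is_deriveM (f := id) (g := id)).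
  have dln := is_derive1_comp dsq (is_derive1_ln (tt_gt0 t t0)).
  have dr : is_derive t 1 r (2^-1 * ((t * t)^-1 * (t * 1 + t * 1))) := is_deriveZ 2^-1 dln.
  by apply: (is_derive_eq dr); field.
exists (fun x => r (ev v x)) => [c|c i _ [x cx <-]].
  apply: smooth_expr_on; first exact: img_open.
  apply: smooth_mul; first exact: smooth_cst.
  apply: smooth_ln => [y _|]; first exact: tt_gt0.
  by apply: smooth_mul; apply: smooth_base; exact: ev_smooth.
have [Y [sY [W [_ Wx _ /(_ x Wx) YE]]]] := even_lift_exists i cx.
have [U [n [f [g [_ Ux /(_ x Ux) loc]]]]] := one_form_local_expression x a1.
rewrite (form_proj_lifts a1 ea VX aX cx sY YE) (form_proj_lifts a1' ea' VX' aX' cx sY YE).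
(* Both projections are computed on the same even lift [Y], so their difference at [x] is the value
   of [Y v] times that of [u], the derivative of [ln |v|]. *)
rewrite (lie_term_change scO la ea lF FE (ev_character x) loc la' a'E sX aX1 sX' aX1' sY).
rewrite opprK addKr YE -/v -/u.
have vE : ev u x = (ev v (cinv c (cmap c x)))^-1.
  by rewrite cmapK //; apply: (mulfI (v0 x)); rewrite uv mulfV.
apply/esym/partialE; rewrite vE mulrC.
apply: (is_derive_comp (f := fun y => ev v (cinv c y)) (phi := r)); last exact: rE.
by apply: (smooth_on_is_derive (V := img c)); [exact: ev_smooth|exists x].
Qed.
End Class.

Theorem mainTheorem1 (R : realType) (p q : nat) (M : superManifold R p q)
    (F : set (superfun M -> superfun M))
    (hF : regular_foliation 0 1 F)
    (a : (superfun M -> superfun M) -> superfun M) (ha : determines a F)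
    (X : superfun M -> superfun M) (hX : Vect X) (haX : a X = 1) :
  (basis_one_form (form_proj (lie_derivative X a)) /\
   basis_closed (form_proj (lie_derivative X a))) /\
  (forall (a' : (superfun M -> superfun M) -> superfun M)
          (X' : superfun M -> superfun M),
     determines a' F -> Vect X' -> a' X' = 1 ->
     cohomologous (form_proj (lie_derivative X a))
                  (form_proj (lie_derivative X' a'))).
Proof.
case: hF => _ _ lF _; case: ha => -[a1 ea] _ FE; split.
  split; first exact: form_proj_basis_one_form.
  exact: form_proj_closed lF FE _ hX haX.
move=> a' X' [[a1' ea'] _ FE'] hX' haX'.
exact: form_proj_cohomologous a1 ea _ lF FE _ _ _ hX haX a1' ea' FE' hX' haX'.
Qed.
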